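(* Suppose the reduced-Hessian, controllability, upper-boundedness, compactness, vanishing-Hessian-modification and local-Lipschitz assumptions stated in the context hold for the SQP iterates, whose search directions satisfy, for all $\tau\ge0$, $\|(\tilde\Delta z^\tau-\Delta z^\tau,\tilde\Delta\lambda^\tau-\Delta\lambda^\tau)\|\le\delta\|(\Delta z^\tau,\Delta\lambda^\tau)\|$ with $\delta\in(0,1)$, and suppose $$\eta_1\ge\frac{17}{\eta_2\gamma_G},\qquad\eta_2\le\frac{\gamma_{RH}}{12\Upsilon^2},\qquad\delta\le\frac{1/2-\beta}{3/2-\beta}\cdot\frac{\eta_2\gamma_G}{9\eta_1\Upsilon^2}.$$ Then $\alpha_\tau=1$ for all sufficiently large $\tau$.
   Context: $[n]=\{0,\dots,n\}$. Consider the nonlinear dynamic program $\min\sum_{k=0}^{N-1}g_k(x_k,u_k)+g_N(x_N)$ s.t. $x_{k+1}=f_k(x_k,u_k)$, $k\in[N-1]$, $x_0=\bar x_0$, with $x_k\in\mathbb{R}^{n_x}$, $u_k\in\mathbb{R}^{n_u}$. Write $z_k=(x_k;u_k)$ ($k<N$), $z_N=x_N$, $z=(z_0;\dots;z_N)$, $f(z)=(x_0-\bar x_0;x_1-f_0(z_0);\dots;x_N-f_{N-1}(z_{N-1}))$, $g(z)$ the objective, $\lambda=(\lambda_0;\dots;\lambda_N)$ with $\lambda_k\in\mathbb{R}^{n_x}$, $\mathcal{L}(z,\lambda)=g(z)+\lambda^Tf(z)$, $\nabla\mathcal{L}=(\nabla_z\mathcal{L};\nabla_\lambda\mathcal{L})$.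 $G(z)$ is the Jacobian of $f$; $A_k(z_k),B_k(z_k)$ are the Jacobians of $f_k$ w.r.t. $x_k,u_k$. $H(z,\lambda)=\nabla_z^2\mathcal{L}=\mathrm{diag}(H_0,\dots,H_N)$, where $H_k$ depends on $(z_k,\lambda_{k+1})$ for $k<N$ and $H_N$ on $z_N$ only. Merit function, $\eta=(\eta_1,\eta_2)$, $\eta_1,\eta_2>0$: $\mathcal{L}_\eta=\mathcal{L}+\frac{\eta_1}{2}\|\nabla_\lambda\mathcal{L}\|^2+\frac{\eta_2}{2}\|\nabla_z\mathcal{L}\|^2$. SQP iterates: superscript $\tau$ denotes evaluation at $(z^\tau,\lambda^\tau)$. $\hat H^\tau=\mathrm{diag}(\hat H_0^\tau,\dots,\hat H_N^\tau)$ is a symmetric modification of $H^\tau$ with the same block diagonal structure. The exact Newton direction $(\Delta z^\tau,\Delta\lambda^\tau)$ solves $\begin{pmatrix}\hat H^\tau&(G^\tau)^T\\ G^\tau&0\end{pmatrix}\begin{pmatrix}\Delta z^\tau\\ \Delta\lambda^\tau\end{pmatrix}=-\nabla\mathcal{L}^\tau$. An approximate direction $(\tilde\Delta z^\tau,\tilde\Delta\lambda^\tau)$ is used: $(z^{\tau+1},\lambda^{\tau+1})=(z^\tau,\lambda^\tau)+\alpha_\tau(\tilde\Delta z^\tau,\tilde\Delta\lambda^\tau)$, where $\alpha_\tau\in(0,1]$ is found by backtracking line search (first element of $1,r,r^2,\dots$ for a fixed $r\in(0,1)$) so that the Armijo condition $\mathcal{L}_\eta^{\tau+1}\le\mathcal{L}_\eta^\tau+\beta\alpha_\tau(\nabla\mathcal{L}_\eta^\tau)^T(\tilde\Delta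 z^\tau;\tilde\Delta\lambda^\tau)$ holds, with fixed $\beta\in(0,1/2)$. Standing assumption: $(z^\tau,\lambda^\tau)\to(z^\star,\lambda^\star)$ as $\tau\to\infty$, where $(z^\star,\lambda^\star)$ is a KKT point, $\nabla\mathcal{L}(z^\star,\lambda^\star)=0$. Assumptions (constants independent of $\tau$). Reduced Hessian: for every $\tau$, if $Z^\tau$ has orthonormal columns spanning $\{w:G^\tau w=0\}$, then $(Z^\tau)^T\hat H^\tau Z^\tau\succeq\gamma_{RH}I$, $\gamma_{RH}>0$. Controllability: with $\Xi_{k,s}=(B_{k+s-1}\ \ A_{k+s-1}B_{k+s-2}\ \cdots\ (A_{k+s-1}\cdots A_{k+1})B_k)$, there are $\gamma_C>0$ and an integer $t>0$ such that for every $\tau$ and $k\in[N-t]$ there is $t_k^\tau\in\{1,\dots,t\}$ with $\Xi^\tau_{k,t_k^\tau}(\Xi^\tau_{k,t_k^\tau})^T\succeq\gamma_C I$. Upper boundedness: $\max\{\|\hat H_k^\tau\|,\|A_k^\tau\|,\|B_k^\tau\|\}\le\Upsilon_{upper}$ for all $k,\tau$. Compactness: there is a compact set $\mathcal{Z}\times\Lambda$, $\mathcal{Z}=\mathcal{Z}_0\times\dots\times\mathcal{Z}_N$, $\Lambda=\Lambda_0\times\dots\times\Lambda_N$, with $(z^\tau+\alpha\tilde\Delta z^\tau,\lambda^\tau+\alpha\tilde\Delta\lambda^\tau)\in\mathcal{Z}\times\Lambda$ for all $\tau\ge0$, $\alpha\in[0,1]$; $g_k,f_k$ are thrice continuously differentiable;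 and $\max\{\sup_{\mathcal{Z}_k\times\Lambda_{k+1}}\|H_k\|,\sup_{\mathcal{Z}_k}\|A_k\|,\sup_{\mathcal{Z}_k}\|B_k\|\}\le\Upsilon_{upper}$ for all $k$ (for $k=N$: $\sup_{\mathcal{Z}_N}\|H_N\|\le\Upsilon_{upper}$). Here $\Upsilon_{upper}>1$. Vanishing Hessian modification: $\|H^\tau-\hat H^\tau\|\to0$ as $\tau\to\infty$. Local Lipschitz: there is $\Upsilon_L$ independent of $k$ such that for any $(z,\lambda),(z',\lambda')$ sufficiently close to $(z^\star,\lambda^\star)$, $\max\{\|A_k(z_k)-A_k(z_k')\|,\|B_k(z_k)-B_k(z_k')\|\}\le\Upsilon_L\|z_k-z_k'\|$ and $\|H_k(z_k,\lambda_{k+1})-H_k(z_k',\lambda_{k+1}')\|\le\Upsilon_L\|(z_k-z_k';\lambda_{k+1}-\lambda'_{k+1})\|$ (for $k=N$ without $\lambda$). Constants: $\gamma_G=\Big(\frac{\gamma_C}{\gamma_C+\Upsilon_{upper}^{t+1}/(\Upsilon_{upper}-1)}\Big)^2\frac{\min\{1,\gamma_C\}}{(1+\Upsilon_{upper})^{2t}}$; $\Upsilon_{HG}>0$ is a constant with $\max\{\sup_{\mathcal{Z}\times\Lambda}\|H\|,\sup_{\mathcal{Z}}\|G\|\}\le\Upsilon_{HG}$; $\Upsilon_{KKT}>0$ is a constant with $\Big\|\begin{pmatrix}\hat H^\tau&(G^\tau)^T\\ G^\tau&0\end{pmatrix}^{-1}\Big\|\le\Upsilon_{KKT}$ for all $\tau$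 (both exist under the assumptions); $\Upsilon=\max\{\Upsilon_{upper},\Upsilon_{KKT},\Upsilon_{HG}\}$. *)

(* Defs.v *)
From HB Require Import structures.
From mathcomp Require Import all_boot all_order all_algebra.
From mathcomp Require Import all_classical all_reals all_analysis.

Set Implicit Arguments.
Unset Strict Implicit.
Unset Printing Implicit Defensive.

Import Order.TTheory GRing.Theory Num.Theory.
Import numFieldNormedType.Exports.

Local Open Scope classical_set_scope.
Local Open Scope ring_scope.

(* The library norm on matrices is the entrywise max norm.  It is only used for
   the topology (limits, continuity, derivatives, compactness), which does not
   depend on the norm in finite dimension.  Every quantitative norm below is
   the Euclidean norm [enorm] or the spectral norm [opnorm]. *)
Section Norms.
Context {R : realType}.

Definition dot n (u v : 'cV[R]_n) : R := (u^T *m v) 0 0.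

Definition enorm n (v : 'cV[R]_n) : R := Num.sqrt (\sum_i v i 0 ^+ 2).

(* The set is nonempty and bounded, so this [sup] is a true supremum. *)
Definition opnorm m n (A : 'M[R]_(m, n)) : R :=
  sup [set enorm (A *m v) | v in [set v : 'cV[R]_n | enorm v <= 1]].

(* M >= c I in the Loewner order; only applied to symmetric matrices *)
Definition loewner_ge n (M : 'M[R]_n) (c : R) : Prop :=
  forall v : 'cV[R]_n, c * enorm v ^+ 2 <= dot v (M *m v).

End Norms.

Section Derivatives.
Context {R : realType}.

Definition jac m n (F : 'cV[R]_n -> 'cV[R]_m) (x : 'cV[R]_n) : 'M[R]_(m, n) :=
  \matrix_(i, j) ('D_(delta_mx j 0) F x) i 0.

Definition grad n (phi : 'cV[R]_n -> R) (x : 'cV[R]_n) : 'cV[R]_n :=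
  \col_i 'D_(delta_mx i 0) phi x.

Definition hess n (phi : 'cV[R]_n -> R) : 'cV[R]_n -> 'M[R]_n := jac (grad phi).

(* gradient of a function of two vectors, (nabla_z F; nabla_lambda F) *)
Definition grad2 m n (F : 'cV[R]_m -> 'cV[R]_n -> R)
    (z : 'cV[R]_m) (lam : 'cV[R]_n) : 'cV[R]_(m + n) :=
  col_mx (grad (F^~ lam) z) (grad (F z) lam).

(* p times continuously differentiable on the whole space *)
Fixpoint cont_diff (V W : normedModType R) (p : nat) (F : V -> W) : Prop :=
  match p with
  | 0 => continuous F
  | q.+1 => (forall x, differentiable F x) /\
            (forall v, cont_diff q (fun x => 'D_v F x))
  end.

End Derivatives.

(* (z_0; ...; z_{N-1}; z_N) with z_k = (x_k; u_k) for k < N and z_N = x_N *)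
Notation dimz nx nu N := (\sum_(i < N) (nx + nu) + nx)%N.
(* (lambda_0; (lambda_1; ...; lambda_N)) *)
Notation diml nx N := (nx + \sum_(i < N) nx)%N.

Section Problem.
Context {R : realType} {nx nu N : nat}.

Local Notation nz := (dimz nx nu N).
Local Notation nl := (diml nx N).

Definition zblk (z : 'cV[R]_nz) (k : 'I_N) : 'cV[R]_(nx + nu) :=
  submxcol (usubmx z) k.

Definition zlast (z : 'cV[R]_nz) : 'cV[R]_nx := dsubmx z.

(* [unlift ord_max k] is [None] when k = N, and k seen in 'I_N otherwise. *)
Definition xblk (z : 'cV[R]_nz) (k : 'I_N.+1) : 'cV[R]_nx :=
  if unlift ord_max k is Some j then usubmx (zblk z j) else zlast z.

(* [unlift ord0 k] is [None] when k = 0, and k - 1 in 'I_N otherwise. *)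
Definition lblk (lam : 'cV[R]_nl) (k : 'I_N.+1) : 'cV[R]_nx :=
  if unlift ord0 k is Some j then submxcol (dsubmx lam) j else usubmx lam.

(* In an index, [lift ord0 k] is k + 1. *)

Record nldp := Nldp {
  stage_cost : 'I_N -> 'cV[R]_(nx + nu) -> R;
  final_cost : 'cV[R]_nx -> R;
  dynamics : 'I_N -> 'cV[R]_(nx + nu) -> 'cV[R]_nx;
  x0bar : 'cV[R]_nx }.

Variable P : nldp.

Definition objective (z : 'cV[R]_nz) : R :=
  \sum_(k < N) stage_cost P k (zblk z k) + final_cost P (zlast z).

Definition constr (z : 'cV[R]_nz) : 'cV[R]_nl :=
  col_mx (xblk z ord0 - x0bar P)
         (\mxcol_(k < N) (xblk z (lift ord0 k) - dynamics P k (zblk z k))).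

Definition lagrangian (z : 'cV[R]_nz) (lam : 'cV[R]_nl) : R :=
  objective z + dot lam (constr z).

Definition gradL : 'cV[R]_nz -> 'cV[R]_nl -> 'cV[R]_(nz + nl) :=
  grad2 lagrangian.

Definition hessL (z : 'cV[R]_nz) (lam : 'cV[R]_nl) : 'M[R]_nz :=
  hess (lagrangian^~ lam) z.

Definition Gmx (z : 'cV[R]_nz) : 'M[R]_(nl, nz) := jac constr z.

Definition Amx (k : 'I_N) (y : 'cV[R]_(nx + nu)) : 'M[R]_nx :=
  lsubmx (jac (dynamics P k) y).

Definition Bmx (k : 'I_N) (y : 'cV[R]_(nx + nu)) : 'M[R]_(nx, nu) :=
  rsubmx (jac (dynamics P k) y).

(* H_k(z_k, lambda_{k+1}), the k-th diagonal block of [hessL]: the part of the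
   Lagrangian that is not affine in z_k is
   g_k(z_k) - lambda_{k+1}^T f_k(z_k). *)
Definition Hblk (k : 'I_N) (y : 'cV[R]_(nx + nu)) (l : 'cV[R]_nx) :
    'M[R]_(nx + nu) :=
  hess (fun y' => stage_cost P k y' - dot l (dynamics P k y')) y.

Definition Hlast (y : 'cV[R]_nx) : 'M[R]_nx := hess (final_cost P) y.

Definition merit (eta1 eta2 : R) (z : 'cV[R]_nz) (lam : 'cV[R]_nl) : R :=
  lagrangian z lam
  + eta1 / 2 * enorm (grad (lagrangian z) lam) ^+ 2
  + eta2 / 2 * enorm (grad (lagrangian^~ lam) z) ^+ 2.

(* Xi_{k,s} = (B_{k+s-1}, A_{k+s-1} B_{k+s-2}, ...,
   (A_{k+s-1} ... A_{k+1}) B_k), by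
   Xi_{k,s+1} = (B_{k+s}, A_{k+s} Xi_{k,s}) *)
Fixpoint ctrb (A : nat -> 'M[R]_nx) (B : nat -> 'M[R]_(nx, nu)) (k s : nat) :
    'M[R]_(nx, s * nu) :=
  match s with
  | 0 => 0
  | s'.+1 => row_mx (B (k + s')%N) (A (k + s')%N *m ctrb A B k s')
  end.

(* extension by 0 of a family on 'I_N; the values at indices >= N are unused *)
Definition ext0 m n (F : 'I_N -> 'M[R]_(m, n)) (k : nat) : 'M[R]_(m, n) :=
  oapp F 0 (insub k).

Definition Xi (z : 'cV[R]_nz) (k s : nat) : 'M[R]_(nx, s * nu) :=
  ctrb (ext0 (fun i => Amx i (zblk z i))) (ext0 (fun i => Bmx i (zblk z i))) k s.

(* (sz, slam): iterates; sHhat, sHhatN: diagonal blocks of the modified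
   Hessian; (sdz, sdlam): exact Newton directions; (sdzt, sdlamt): approximate
   directions; salpha: step sizes *)
Record iterates := Iterates {
  sz : nat -> 'cV[R]_nz;
  slam : nat -> 'cV[R]_nl;
  sHhat : nat -> 'I_N -> 'M[R]_(nx + nu);
  sHhatN : nat -> 'M[R]_nx;
  sdz : nat -> 'cV[R]_nz;
  sdlam : nat -> 'cV[R]_nl;
  sdzt : nat -> 'cV[R]_nz;
  sdlamt : nat -> 'cV[R]_nl;
  salpha : nat -> R }.

Variable S : iterates.

Definition Hhat (tau : nat) : 'M[R]_nz :=
  block_mx (\mxdiag_(k < N) sHhat S tau k) 0 0 (sHhatN S tau).

Definition KKTmx (tau : nat) : 'M[R]_(nz + nl) :=
  block_mx (Hhat tau) (Gmx (sz S tau))^T (Gmx (sz S tau)) 0.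

Definition armijo (eta1 eta2 beta : R) (tau : nat) (a : R) : Prop :=
  merit eta1 eta2 (sz S tau + a *: sdzt S tau) (slam S tau + a *: sdlamt S tau)
  <= merit eta1 eta2 (sz S tau) (slam S tau)
     + beta * a * dot (grad2 (merit eta1 eta2) (sz S tau) (slam S tau))
                      (col_mx (sdzt S tau) (sdlamt S tau)).

Record sqp_run (eta1 eta2 beta r : R) : Prop := SqpRun {
  sqp_sym : forall tau,
    (forall k, (sHhat S tau k)^T = sHhat S tau k) /\
    (sHhatN S tau)^T = sHhatN S tau;
  sqp_newton : forall tau,
    KKTmx tau *m col_mx (sdz S tau) (sdlam S tau)
    = - gradL (sz S tau) (slam S tau);
  sqp_step : forall tau,
    sz S tau.+1 = sz S tau + salpha S tau *: sdzt S tau /\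
    slam S tau.+1 = slam S tau + salpha S tau *: sdlamt S tau;
  sqp_linesearch : forall tau, exists j : nat,
    [/\ salpha S tau = r ^+ j,
        armijo eta1 eta2 beta tau (r ^+ j) &
        forall i, (i < j)%N -> ~ armijo eta1 eta2 beta tau (r ^+ i)] }.

Definition inexact_direction (delta : R) : Prop := forall tau,
  enorm (col_mx (sdzt S tau - sdz S tau) (sdlamt S tau - sdlam S tau))
  <= delta * enorm (col_mx (sdz S tau) (sdlam S tau)).

Definition reduced_hessian (gRH : R) : Prop :=
  0 < gRH /\
  forall (tau q : nat) (Z : 'M[R]_(nz, q)),
    Z^T *m Z = 1%:M ->
    (forall w : 'cV[R]_nz,
       Gmx (sz S tau) *m w = 0 <-> exists y : 'cV[R]_q, w = Z *m y) ->
    loewner_ge (Z^T *m Hhat tau *m Z) gRH.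

Definition controllability (gC : R) (t : nat) : Prop :=
  [/\ 0 < gC, (0 < t)%N &
  forall tau k : nat, (k + t <= N)%N ->
    exists2 tk : nat, (1 <= tk <= t)%N &
      loewner_ge (Xi (sz S tau) k tk *m (Xi (sz S tau) k tk)^T) gC].

Definition upper_bounded (U : R) : Prop := forall tau : nat,
  (forall k : 'I_N,
     [/\ opnorm (sHhat S tau k) <= U,
         opnorm (Amx k (zblk (sz S tau) k)) <= U &
         opnorm (Bmx k (zblk (sz S tau) k)) <= U]) /\
  opnorm (sHhatN S tau) <= U.

(* The set Z_0 x ... x Z_N x Lambda_0 x ... x Lambda_N is given by its
   factors Zs k = Z_k (k < N), ZN = Z_N, Ls k = Lambda_k (k <= N). *)
Record boxes := Boxes {
  Zs : 'I_N -> set 'cV[R]_(nx + nu);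
  ZN : set 'cV[R]_nx;
  Ls : 'I_N.+1 -> set 'cV[R]_nx }.

Definition Zset (X : boxes) : set 'cV[R]_nz :=
  [set z | (forall k, Zs X k (zblk z k)) /\ ZN X (zlast z)].

Definition Lset (X : boxes) : set 'cV[R]_nl :=
  [set lam | forall k, Ls X k (lblk lam k)].

(* The suprema are written as bounds over all points of the sets, since the
   library's real-valued [sup] is 0 on unbounded sets. *)
Record compactness (X : boxes) (U : R) : Prop := Compactness {
  cpt_sets : [/\ forall k, compact (Zs X k), compact (ZN X) &
                 forall k, compact (Ls X k)];
  cpt_iter : forall (tau : nat) (a : R), 0 <= a <= 1 ->
    Zset X (sz S tau + a *: sdzt S tau) /\
    Lset X (slam S tau + a *: sdlamt S tau);
  cpt_C3 : [/\ forall k, cont_diff 3 (stage_cost P k),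
               cont_diff 3 (final_cost P) &
               forall k, cont_diff 3 (dynamics P k)];
  cpt_H : forall k y l, Zs X k y -> Ls X (lift ord0 k) l ->
    opnorm (Hblk k y l) <= U;
  cpt_HN : forall y, ZN X y -> opnorm (Hlast y) <= U;
  cpt_AB : forall k y, Zs X k y ->
    opnorm (Amx k y) <= U /\ opnorm (Bmx k y) <= U }.

Definition vanishing_modification : Prop :=
  opnorm (hessL (sz S tau) (slam S tau) - Hhat tau) @[tau --> \oo] --> (0 : R).

Definition local_lipschitz (zs : 'cV[R]_nz) (ls : 'cV[R]_nl) : Prop :=
  exists UL eps : R, 0 < eps /\
  forall (z z' : 'cV[R]_nz) (lam lam' : 'cV[R]_nl),
    enorm (col_mx (z - zs) (lam - ls)) < eps ->
    enorm (col_mx (z' - zs) (lam' - ls)) < eps ->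
    (forall k : 'I_N,
      [/\ opnorm (Amx k (zblk z k) - Amx k (zblk z' k))
            <= UL * enorm (zblk z k - zblk z' k),
          opnorm (Bmx k (zblk z k) - Bmx k (zblk z' k))
            <= UL * enorm (zblk z k - zblk z' k) &
          opnorm (Hblk k (zblk z k) (lblk lam (lift ord0 k))
                  - Hblk k (zblk z' k) (lblk lam' (lift ord0 k)))
            <= UL * enorm (col_mx (zblk z k - zblk z' k)
                             (lblk lam (lift ord0 k)
                              - lblk lam' (lift ord0 k)))]) /\
    opnorm (Hlast (zlast z) - Hlast (zlast z'))
      <= UL * enorm (zlast z - zlast z').

Definition HG_bound (X : boxes) (UHG : R) : Prop :=
  (forall z lam, Zset X z -> Lset X lam -> opnorm (hessL z lam) <= UHG) /\
  (forall z, Zset X z -> opnorm (Gmx z) <= UHG).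

(* The reduced Hessian bound makes KKTmx invertible (G has full row rank), so
   [invmx] is the actual inverse. *)
Definition KKT_bound (UKKT : R) : Prop :=
  forall tau, opnorm (invmx (KKTmx tau)) <= UKKT.

End Problem.

Arguments nldp : clear implicits.
Arguments iterates : clear implicits.
Arguments boxes : clear implicits.

Definition gamma_G {R : realType} (gC U : R) (t : nat) : R :=
  (gC / (gC + U ^+ t.+1 / (U - 1))) ^+ 2
  * (Num.min 1 gC / (1 + U) ^+ (2 * t)).

(* Main.v *)
Require Import Defs.
From HB Require Import structures.
From mathcomp Require Import all_boot all_order all_algebra.
From mathcomp Require Import all_classical all_reals all_analysis.
From mathcomp Require Import ring lra.

Set Implicit Arguments.
Unset Strict Implicit.
Unset Printing Implicit Defensive.

Import Order.TTheory GRing.Theory Num.Theory.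
Import numFieldNormedType.Exports.

Local Open Scope classical_set_scope.
Local Open Scope ring_scope.

(** The merit function and the unit step.

    Stack the iterate into [w = (z; lam)] and let [Phi w] be the Lagrangian, so
    that the merit function is [Phi + <grad Phi, grad Phi>_E / 2] with the
    weighted inner product [E = diag(eta2, eta1)] ([wdot]). Let [K] be the KKT
    matrix with modified Hessian, [Delta] the Newton direction, so that
    [grad Phi w = - K Delta], and [d = Delta + e] the direction actually used,
    with [|e| <= delta |Delta|]. With [B = K + K E K] (the form [bil]), the
    slope of the merit function along [d] is [- Delta^T B d + o(|Delta|^2)] and
    its increment over the unit step is
    [- Delta^T B d + d^T B d / 2 + o(|Delta|^2)]: the Hessian modification
    vanishes, the expansions of [Phi] and of [grad Phi] are uniform near the
    limit point ([taylor2], [strict_diff]), and [grad Phi w] is itself of the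
    order of [|Delta|]. The Armijo condition for the unit step therefore
    amounts to
    [(1/2 - beta) Delta^T B Delta > beta Delta^T B e + e^T B e / 2] with a
    margin of the order of [|Delta|^2] ([unit_step_decrease]).

    Two estimates give the margin. From above, [B] is bounded by
    [eta1 U^2] up to ten percent, because [eta1] is large ([bil_saddle_le],
    [step_margin]). From below, [Delta^T B Delta >= eta2 gamma_G / 9 |Delta|^2]
    ([bil_saddle_ge]): the reduced Hessian gives positivity on the kernel of the
    constraint Jacobian [G], the penalty [eta1] on its row space, the penalty
    [eta2] in the multipliers; this uses [G G^T >= (4 / 9) gamma_G].

    That last bound is where controllability enters ([Gmx_tr_ge]). The equation
    [G^T q = r] is a backward recursion for the multipliers, driven by the state
    blocks of [r], together with an observation of them, the control blocks of
    [r]. On a window of length [s] with reachability Gramian at least [g], the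
    observations bound the multiplier at the end of the window by [r], with a
    loss [1 / sqrt g], and the recursion then bounds those inside the window
    ([block_le]). Disjoint windows cover the horizon ([adjoint_le]). When [gC]
    is much larger than [Uupper^2] the direct estimate is worse than [gamma_G]
    allows; but then the Gramian cannot be due to the last control alone, the
    last state matrix is invertible, and the window shortened by one step is
    still controllable ([ctrb_shorten]). Repeating this until
    [g <= 2 Uupper^2] gives the stated constant up to the factor [4 / 9] ([block_exists]). *)

(** * Euclidean and spectral norms *)

Section Euclid.
Context {R : realType}.
Implicit Types n m : nat.

Lemma dotE n (u v : 'cV[R]_n) : dot u v = \sum_i u i 0 * v i 0.
Proof. by rewrite /dot mxE; apply: eq_bigr => i _; rewrite mxE. Qed.

Lemma dotC n (u v : 'cV[R]_n) : dot u v = dot v u.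
Proof. by rewrite !dotE; apply: eq_bigr => i _; rewrite mulrC. Qed.

Lemma dotDr n (u v w : 'cV[R]_n) : dot u (v + w) = dot u v + dot u w.
Proof. by rewrite /dot mulmxDr mxE. Qed.

Lemma dotDl n (u v w : 'cV[R]_n) : dot (u + v) w = dot u w + dot v w.
Proof. by rewrite dotC dotDr !(dotC w). Qed.

Lemma dotZr n a (u v : 'cV[R]_n) : dot u (a *: v) = a * dot u v.
Proof. by rewrite /dot -scalemxAr mxE. Qed.

Lemma dotZl n a (u v : 'cV[R]_n) : dot (a *: u) v = a * dot u v.
Proof. by rewrite dotC dotZr dotC. Qed.

Lemma dotNr n (u v : 'cV[R]_n) : dot u (- v) = - dot u v.
Proof. by rewrite -scaleN1r dotZr mulN1r. Qed.

Lemma dotNl n (u v : 'cV[R]_n) : dot (- u) v = - dot u v.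
Proof. by rewrite dotC dotNr dotC. Qed.

Lemma dotBr n (u v w : 'cV[R]_n) : dot u (v - w) = dot u v - dot u w.
Proof. by rewrite dotDr dotNr. Qed.

Lemma dotBl n (u v w : 'cV[R]_n) : dot (u - v) w = dot u w - dot v w.
Proof. by rewrite dotDl dotNl. Qed.

Lemma dot0r n (u : 'cV[R]_n) : dot u 0 = 0.
Proof. by rewrite /dot mulmx0 mxE. Qed.

Lemma dot0l n (u : 'cV[R]_n) : dot 0 u = 0.
Proof. by rewrite dotC dot0r. Qed.

Lemma dot_mul n m (u : 'cV[R]_m) (A : 'M[R]_(m, n)) (v : 'cV[R]_n) :
  dot u (A *m v) = dot (A^T *m u) v.
Proof. by rewrite /dot trmx_mul trmxK mulmxA. Qed.

Lemma dot_col n m (u u' : 'cV[R]_n) (v v' : 'cV[R]_m) :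
  dot (col_mx u v) (col_mx u' v') = dot u u' + dot v v'.
Proof. by rewrite /dot tr_col_mx mul_row_col mxE. Qed.

Lemma dot_mxcol p (q_ : 'I_p -> nat) (u v : forall i, 'cV[R]_(q_ i)) :
  dot (\mxcol_i u i) (\mxcol_i v i) = \sum_i dot (u i) (v i).
Proof. by rewrite /dot tr_mxcol mul_mxrow_mxcol summxE. Qed.

Lemma dot_delta n (i : 'I_n) (v : 'cV[R]_n) : dot (delta_mx i 0) v = v i 0.
Proof.
rewrite dotE (bigD1 i)//= big1 => [|j ji].
  by rewrite mxE !eqxx mul1r addr0.
by rewrite mxE (negPf ji) mul0r.
Qed.

Lemma dot_ge0 n (v : 'cV[R]_n) : 0 <= dot v v.
Proof. by rewrite dotE sumr_ge0// => i _; rewrite -expr2 sqr_ge0. Qed.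

Lemma sqr_enorm n (v : 'cV[R]_n) : enorm v ^+ 2 = dot v v.
Proof.
rewrite /enorm sqr_sqrtr ?sumr_ge0// => [|i _]; last exact: sqr_ge0.
by rewrite dotE; apply: eq_bigr => i _; rewrite expr2.
Qed.

Lemma enorm_ge0 n (v : 'cV[R]_n) : 0 <= enorm v.
Proof. exact: sqrtr_ge0. Qed.

Lemma enorm0 n : enorm (0 : 'cV[R]_n) = 0.
Proof. by apply/eqP; rewrite -sqrf_eq0 sqr_enorm dot0r. Qed.

Lemma enorm_eq0 n (v : 'cV[R]_n) : enorm v = 0 -> v = 0.
Proof.
move=> v0; have : dot v v = 0 by rewrite -sqr_enorm v0 expr0n.
rewrite dotE => /eqP; rewrite psumr_eq0 => [/allP h|i _]; last first.
  by rewrite -expr2 sqr_ge0.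
apply/matrixP => i j; rewrite ord1 mxE.
by have /= := h i (mem_index_enum _); rewrite -expr2 sqrf_eq0 => /eqP.
Qed.

Lemma enorm_gt0 n (v : 'cV[R]_n) : v != 0 -> 0 < enorm v.
Proof.
move=> v0; rewrite lt_neqAle enorm_ge0 andbT eq_sym.
by apply: contra_neq v0; exact: enorm_eq0.
Qed.

Lemma enormZ n a (v : 'cV[R]_n) : enorm (a *: v) = `|a| * enorm v.
Proof.
apply/eqP; rewrite -(@eqrXn2 _ 2) ?enorm_ge0 ?mulr_ge0 ?enorm_ge0//.
by rewrite sqr_enorm dotZr dotZl exprMn sqr_enorm real_normK ?num_real// mulrA.
Qed.

Lemma enormN n (v : 'cV[R]_n) : enorm (- v) = enorm v.
Proof. by rewrite -scaleN1r enormZ normrN1 mul1r. Qed.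

(** Cauchy-Schwarz: the residual of projecting [u] on [v] has a nonnegative
    square. *)
Lemma dot_le n (u v : 'cV[R]_n) : `|dot u v| <= enorm u * enorm v.
Proof.
have [->|v0] := eqVneq v 0; first by rewrite dot0r normr0 enorm0 mulr0.
have vv : 0 < dot v v by rewrite -sqr_enorm exprn_gt0// enorm_gt0.
rewrite -ler_sqr ?nnegrE ?mulr_ge0 ?enorm_ge0//.
rewrite exprMn !sqr_enorm real_normK ?num_real//.
have := dot_ge0 (dot v v *: u - dot u v *: v).
rewrite !(dotBl, dotBr, dotZl, dotZr) (dotC v u).
set a := dot u u; set b := dot v v; set c := dot u v => H.
by rewrite -subr_ge0 -(pmulr_rge0 _ vv); move: H; rewrite -/b; lra.
Qed.

Lemma dot_ler n (u v : 'cV[R]_n) : dot u v <= enorm u * enorm v.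
Proof. exact: le_trans (ler_norm _) (dot_le _ _). Qed.

Lemma enormD n (u v : 'cV[R]_n) : enorm (u + v) <= enorm u + enorm v.
Proof.
rewrite -ler_sqr ?nnegrE ?addr_ge0 ?enorm_ge0//.
rewrite sqr_enorm !(dotDl, dotDr) (dotC v u) sqrrD !sqr_enorm.
by have := dot_ler u v; lra.
Qed.

Lemma enormB_le n (u v : 'cV[R]_n) : enorm (u - v) <= enorm u + enorm v.
Proof. by rewrite -(enormN v) enormD. Qed.

Lemma sqr_enorm_col n m (u : 'cV[R]_n) (v : 'cV[R]_m) :
  enorm (col_mx u v) ^+ 2 = enorm u ^+ 2 + enorm v ^+ 2.
Proof. by rewrite !sqr_enorm dot_col. Qed.

Lemma sqr_enorm_mxcol p (q_ : 'I_p -> nat) (u : forall i, 'cV[R]_(q_ i)) :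
  enorm (\mxcol_i u i) ^+ 2 = \sum_i enorm (u i) ^+ 2.
Proof.
by rewrite sqr_enorm dot_mxcol; apply: eq_bigr => i _; rewrite sqr_enorm.
Qed.

Lemma enorm_colL n m (u : 'cV[R]_n) (v : 'cV[R]_m) :
  enorm u <= enorm (col_mx u v).
Proof.
rewrite -ler_sqr ?nnegrE ?enorm_ge0// sqr_enorm_col lerDl.
by rewrite sqr_ge0.
Qed.

Lemma enorm_colR n m (u : 'cV[R]_n) (v : 'cV[R]_m) :
  enorm v <= enorm (col_mx u v).
Proof.
rewrite -ler_sqr ?nnegrE ?enorm_ge0// sqr_enorm_col lerDr.
by rewrite sqr_ge0.
Qed.

Lemma enorm_col_le n m (u : 'cV[R]_n) (v : 'cV[R]_m) :
  enorm (col_mx u v) <= enorm u + enorm v.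
Proof.
rewrite -ler_sqr ?nnegrE ?addr_ge0 ?enorm_ge0// sqr_enorm_col.
by rewrite sqrrD lerD2r lerDl mulrn_wge0// mulr_ge0 ?enorm_ge0.
Qed.

Lemma coord_le_enorm n (v : 'cV[R]_n) i : `|v i 0| <= enorm v.
Proof.
rewrite -ler_sqr ?nnegrE ?enorm_ge0// real_normK ?num_real//.
rewrite sqr_enorm dotE (bigD1 i)//= expr2 lerDl sumr_ge0// => j _.
by rewrite -expr2 sqr_ge0.
Qed.

Lemma enorm_le_sum n (v : 'cV[R]_n) : enorm v <= \sum_i `|v i 0|.
Proof.
have S0 : 0 <= \sum_i `|v i 0| by apply: sumr_ge0.
have [->|v0] := eqVneq v 0; first by rewrite enorm0 sumr_ge0.
rewrite -(ler_pM2r (enorm_gt0 v0)) -expr2 sqr_enorm dotE mulr_suml.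
apply: ler_sum => i _; apply: le_trans (ler_norm _) _.
by rewrite normrM ler_wpM2l// coord_le_enorm.
Qed.

Lemma opnorm_bounded n m (A : 'M[R]_(m, n)) :
  has_sup [set enorm (A *m v) | v in [set v : 'cV[R]_n | enorm v <= 1]].
Proof.
split; first by exists (enorm (A *m 0)); exists 0 => //=; rewrite enorm0.
exists (\sum_i enorm (row i A)^T) => _ [v /= v1 <-].
apply: le_trans (enorm_le_sum _) _; apply: ler_sum => i _.
have -> : (A *m v) i 0 = dot (row i A)^T v.
  by rewrite /dot trmxK -row_mul [RHS]mxE.
apply: le_trans (dot_le _ _) _.
by rewrite ler_piMr ?enorm_ge0.
Qed.

Lemma opnormP n m (A : 'M[R]_(m, n)) v : enorm (A *m v) <= opnorm A * enorm v.
Proof.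
have [->|v0] := eqVneq v 0; first by rewrite mulmx0 !enorm0 mulr0.
have vp := enorm_gt0 v0.
rewrite -ler_pdivrMr// mulrC.
have -> : (enorm v)^-1 * enorm (A *m v) = enorm (A *m ((enorm v)^-1 *: v)).
  by rewrite -scalemxAr enormZ ger0_norm// invr_ge0 ltW.
apply: ub_le_sup; first by case: (opnorm_bounded A).
exists ((enorm v)^-1 *: v) => //=.
by rewrite enormZ ger0_norm ?invr_ge0 ?enorm_ge0 ?mulVf ?lexx ?gt_eqF.
Qed.

Lemma opnorm_leP n m (A : 'M[R]_(m, n)) c v :
  opnorm A <= c -> enorm (A *m v) <= c * enorm v.
Proof.
by move=> Ac; apply: le_trans (opnormP _ _) _; rewrite ler_wpM2r ?enorm_ge0.
Qed.

Lemma mul_tr_le n m (A : 'M[R]_(m, n)) c : 0 <= c ->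
  (forall v, enorm (A *m v) <= c * enorm v) ->
  forall u, enorm (A^T *m u) <= c * enorm u.
Proof.
move=> c0 Ac u; have [->|w0] := eqVneq (A^T *m u) 0.
  by rewrite enorm0 mulr_ge0 ?enorm_ge0.
rewrite -(ler_pM2r (enorm_gt0 w0)) -expr2 sqr_enorm -dot_mul.
apply: le_trans (dot_ler _ _) _.
by rewrite (mulrC c) -mulrA ler_wpM2l ?enorm_ge0.
Qed.

Lemma unitmx_inj n (M : 'M[R]_n) :
  (forall v : 'cV[R]_n, M *m v = 0 -> v = 0) -> M \in unitmx.
Proof.
move=> inj; rewrite -unitmx_tr -row_free_unit -kermx_eq0; apply/eqP/row_matrixP => i.
rewrite row0; apply: trmx_inj; rewrite trmx0; apply: inj.
have : row i (kermx M^T) *m M^T = 0 by rewrite -row_mul mulmx_ker row0.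
by move/(congr1 trmx); rewrite trmx_mul trmxK trmx0.
Qed.

End Euclid.

(** * Backward recursions along a controllable linear system *)

Section Controllability.
Context {R : realType} {nx nu : nat}.
Variables (A : nat -> 'M[R]_nx) (B : nat -> 'M[R]_(nx, nu)) (U : R).
Hypothesis hnx : (0 < nx)%N.
Hypothesis U1 : 1 < U.
Hypothesis Ale : forall k v, enorm ((A k)^T *m v) <= U * enorm v.
Hypothesis Ble : forall k v, enorm ((B k)^T *m v) <= U * enorm v.

Let U0 : 0 < U. Proof. exact: lt_trans ltr01 U1. Qed.
Let W := 1 + U.
Let W1 : 1 <= W. Proof. by rewrite lerDl ltW. Qed.
Let W2 : 2 <= W. Proof. by rewrite /W; move: U1; lra. Qed.
Let W0 : 0 < W. Proof. exact: lt_le_trans ltr01 W1. Qed.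

Definition geosum (s : nat) : R := \sum_(i < s) U ^+ i.

Lemma geosumS s : geosum s.+1 = 1 + U * geosum s.
Proof.
rewrite /geosum big_ord_recl expr0 mulr_sumr; congr (_ + _).
by apply: eq_bigr => i _; rewrite exprS.
Qed.

Lemma geosum_ge0 s : 0 <= geosum s.
Proof. by apply: sumr_ge0 => i _; rewrite exprn_ge0// ltW. Qed.

Lemma geosum_le s : geosum s.+1 <= W ^+ s.
Proof.
elim: s => [|s IH]; first by rewrite /geosum big_ord1 !expr0.
rewrite geosumS exprS; have : 1 <= W ^+ s by rewrite exprn_ege1.
move: IH; rewrite /W; set w := (1 + U) ^+ s; set g := geosum _ => gw w1.
have : U * g <= U * w by rewrite ler_pM2l.
by lra.
Qed.

Lemma geosum_mul s : geosum s * (U - 1) = U ^+ s - 1.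
Proof.
elim: s => [|s IH]; first by rewrite /geosum big_ord0 mul0r expr0 subrr.
by rewrite geosumS mulrDl -mulrA IH exprS; ring.
Qed.

Lemma mul_ctrb_tr k s (v : 'cV[R]_nx) : (ctrb A B k s.+1)^T *m v =
  col_mx ((B (k + s))^T *m v) ((ctrb A B k s)^T *m ((A (k + s))^T *m v)).
Proof. by rewrite /= tr_row_mx mul_col_mx trmx_mul mulmxA. Qed.

Lemma ctrb_le k s (v : 'cV[R]_nx) :
  enorm ((ctrb A B k s)^T *m v) <= U * geosum s * enorm v.
Proof.
elim: s v => [|s IH] v.
  rewrite /= trmx0 mul0mx enorm0 mulr_ge0 ?enorm_ge0// mulr_ge0 ?geosum_ge0//.
  exact: ltW.
rewrite mul_ctrb_tr geosumS; apply: le_trans (enorm_col_le _ _) _.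
have h1 := Ble (k + s) v; have h2 := IH ((A (k + s))^T *m v).
have h3 : U * geosum s * enorm ((A (k + s))^T *m v) <= U * geosum s * (U * enorm v).
  by rewrite ler_wpM2l// mulr_ge0 ?geosum_ge0// ltW.
by lra.
Qed.

Variable q : nat -> 'cV[R]_nx.

(** For the adjoint recursion [q j = rx j + (A j)^T *m q j.+1], the residuals
    [rx] and [ru] are, up to sign, the state and control blocks of the transposed
    constraint Jacobian applied to [q]. *)
Definition rx j : 'cV[R]_nx := q j - (A j)^T *m q j.+1.
Definition ru j : 'cV[R]_nu := (B j)^T *m q j.+1.
Definition rho j : R := enorm (rx j) ^+ 2 + enorm (ru j) ^+ 2.
Definition wnorm (F : nat -> R) k s : R := Num.sqrt (\sum_(k <= j < k + s) F j).

Lemma rho_ge0 j : 0 <= rho j.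
Proof. by rewrite addr_ge0 ?sqr_ge0. Qed.

Lemma sqr_wnorm F k s : (forall j, 0 <= F j) ->
  wnorm F k s ^+ 2 = \sum_(k <= j < k + s) F j.
Proof. by move=> F0; rewrite sqr_sqrtr// sumr_ge0. Qed.

Lemma wnorm_ge0 F k s : 0 <= wnorm F k s.
Proof. exact: sqrtr_ge0. Qed.

Lemma sqr_wnormS F k s : (forall j, 0 <= F j) ->
  wnorm F k s.+1 ^+ 2 = wnorm F k s ^+ 2 + F (k + s)%N.
Proof.
by move=> F0; rewrite !sqr_wnorm// addnS big_nat_recr ?leq_addr.
Qed.

Lemma wnormS_ge F k s : (forall j, 0 <= F j) ->
  wnorm F k s <= wnorm F k s.+1.
Proof.
by move=> F0; rewrite -ler_sqr ?nnegrE ?wnorm_ge0// sqr_wnormS// lerDl.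
Qed.

Lemma rx_le k s : enorm (rx (k + s)) <= wnorm rho k s.+1.
Proof.
rewrite -ler_sqr ?nnegrE ?wnorm_ge0 ?enorm_ge0// sqr_wnormS; last exact: rho_ge0.
have := sqr_ge0 (wnorm rho k s); have := sqr_ge0 (enorm (ru (k + s))).
by rewrite /rho; lra.
Qed.

Let q2 j := enorm (q j) ^+ 2.
Let q2_ge0 j : 0 <= q2 j. Proof. exact: sqr_ge0. Qed.

(** Unrolling the recursion backwards from the end of a window. *)
Lemma window_le k s : wnorm q2 k s <=
  U * geosum s * enorm (q (k + s)) + W ^+ s * wnorm rho k s.
Proof.
elim: s => [|s IH].
  rewrite {1}/wnorm addn0 big_geq// sqrtr0.
  rewrite addr_ge0// mulr_ge0 ?enorm_ge0 ?wnorm_ge0 ?exprn_ge0 ?(ltW W0)//.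
  by rewrite mulr_ge0 ?geosum_ge0// ltW.
have step : wnorm q2 k s.+1 <= wnorm q2 k s + enorm (q (k + s)).
  rewrite -ler_sqr ?nnegrE ?addr_ge0 ?wnorm_ge0 ?enorm_ge0// sqr_wnormS//.
  rewrite sqrrD /q2 lerD2r lerDl mulrn_wge0// mulr_ge0 ?wnorm_ge0 ?enorm_ge0//.
have qs : enorm (q (k + s)) <= enorm (rx (k + s)) + U * enorm (q (k + s.+1)).
  have {1}-> : q (k + s)%N = rx (k + s) + (A (k + s))^T *m q (k + s.+1)%N.
    by rewrite /rx addnS subrK.
  by apply: le_trans (enormD _ _) _; rewrite lerD2l Ale.
have rxs := rx_le k s.
have Rs := wnormS_ge k s rho_ge0.
have gs := geosum_le s; have gS := geosumS s; have g0 := geosum_ge0 s.+1.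
have w0 : 0 <= W ^+ s by rewrite exprn_ge0// ltW.
move: (wnorm_ge0 rho k s) (enorm_ge0 (rx (k + s))) => r0 x0.
move: (enorm_ge0 (q (k + s.+1))) => y0.
set y := enorm (q (k + s.+1)) in qs y0 *.
set x := enorm (q (k + s)) in qs IH step.
set z := enorm (rx _) in qs x0 rxs; set r := wnorm rho k s in IH Rs r0.
set r' := wnorm rho k s.+1 in rxs Rs *; set T := geosum s in gS IH.
have h1 : wnorm q2 k s.+1 <= geosum s.+1 * x + W ^+ s * r.
  by rewrite gS; move: step IH; lra.
have h2 : geosum s.+1 * x <= geosum s.+1 * (z + U * y) by rewrite ler_wpM2l.
have h3 : geosum s.+1 * z <= W ^+ s * r' by rewrite ler_pM.
have h4 : W ^+ s * r <= W ^+ s * r' by rewrite ler_wpM2l.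
have h5 : 2 * (W ^+ s * r') <= W * (W ^+ s * r').
  by rewrite ler_wpM2r// mulr_ge0// (le_trans r0).
by rewrite exprS; move: h1 h2 h3 h4 h5; set w := W ^+ s; lra.
Qed.

(** Along the recursion each block of the transposed reachability matrix applied
    to the end of the window is a control residual plus propagated state
    residuals. *)
Lemma observe_le k s :
  enorm ((ctrb A B k s.+1)^T *m q (k + s.+1)) <= W ^+ s * wnorm rho k s.+1.
Proof.
elim: s => [|s IH].
  rewrite -ler_sqr ?nnegrE ?enorm_ge0 ?mulr_ge0 ?wnorm_ge0 ?exprn_ge0 ?(ltW W0)//.
  rewrite mul_ctrb_tr sqr_enorm_col /= trmx0 mul0mx enorm0 expr0 mul1r.
  rewrite expr0n addr0 sqr_wnormS; last exact: rho_ge0.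
  rewrite /rho /ru addn1 addn0.
  have := sqr_ge0 (wnorm rho k 0); have := sqr_ge0 (enorm (rx k)).
  by rewrite /rho; lra.
rewrite mul_ctrb_tr.
have -> : (A (k + s.+1))^T *m q (k + s.+2)%N = q (k + s.+1)%N - rx (k + s.+1).
  by rewrite /rx !addnS opprB addrC subrK.
rewrite -ler_sqr ?nnegrE ?enorm_ge0 ?mulr_ge0 ?wnorm_ge0 ?exprn_ge0 ?(ltW W0)//.
rewrite sqr_enorm_col mulmxBr.
rewrite exprMn sqr_wnormS; last exact: rho_ge0.
rewrite [rho _]/rho (_ : (B _)^T *m q _ = ru (k + s.+1)); last by rewrite /ru !addnS.
set n' := enorm (_ - _); set n := enorm (_ *m q _) in IH.
have gs := geosum_le s.
have n'le : n' <= n + U * geosum s.+1 * enorm (rx (k + s.+1)).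
  by apply: le_trans (enormB_le _ _) _; rewrite lerD2l; exact: (ctrb_le k s.+1).
have n'0 : 0 <= n' by exact: enorm_ge0.
have x0 := enorm_ge0 (rx (k + s.+1)); have r0 := wnorm_ge0 rho k s.+1.
set x := enorm (rx _) in n'le x0 *; set r := wnorm rho k s.+1 in IH r0 *.
set b := enorm (ru _); have b0 : 0 <= b by exact: enorm_ge0.
rewrite [W ^+ s.+1]exprS; set w := W ^+ s in IH gs *.
have w1 : 1 <= w by rewrite exprn_ege1.
have m1 : n' <= w * r + U * w * x.
  have : U * geosum s.+1 * x <= U * w * x by rewrite ler_wpM2r// ler_pM2l.
  by move: n'le IH; lra.
have m2 : n' ^+ 2 <= (w * r + U * w * x) ^+ 2.
  by rewrite ler_sqr ?nnegrE// (le_trans n'0).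
have m3 : (w * r + U * w * x) ^+ 2 <= w ^+ 2 * ((1 + U ^+ 2) * (r ^+ 2 + x ^+ 2)).
  have -> : w * r + U * w * x = w * (r + U * x) by ring.
  rewrite exprMn ler_pM2l ?exprn_gt0 ?(lt_le_trans ltr01)//.
  by have := sqr_ge0 (x - U * r); rewrite !expr2; lra.
have m4 : w ^+ 2 * ((1 + U ^+ 2) * (r ^+ 2 + x ^+ 2)) <=
    w ^+ 2 * (W ^+ 2 * (r ^+ 2 + x ^+ 2)).
  rewrite ler_pM2l ?exprn_gt0 ?(lt_le_trans ltr01)//.
  by rewrite ler_wpM2r ?addr_ge0 ?sqr_ge0// /W !expr2; move: U0; lra.
have m5 : b ^+ 2 <= (W * w) ^+ 2 * b ^+ 2.
  rewrite ler_peMl ?sqr_ge0// exprn_ege1// mulr_ege1//.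
rewrite exprMn in m5 *.
by move: m2 m3 m4 m5; lra.
Qed.

Definition ctrb_ge k s g :=
  forall v : 'cV[R]_nx, g * enorm v ^+ 2 <= enorm ((ctrb A B k s)^T *m v) ^+ 2.

Lemma block_le k s c : 0 < c -> ctrb_ge k s.+1 (c ^+ 2) ->
  wnorm q2 k s.+1 <=
  (W ^+ s.+1 + U * geosum s.+1 * W ^+ s / c) * wnorm rho k s.+1.
Proof.
move=> c0 hc; apply: le_trans (window_le _ _) _.
have : enorm (q (k + s.+1)) <= W ^+ s * wnorm rho k s.+1 / c.
  rewrite ler_pdivlMr// mulrC; apply: le_trans (observe_le _ _).
  rewrite -ler_sqr ?nnegrE ?enorm_ge0 ?mulr_ge0 ?enorm_ge0 ?(ltW c0)//.
  by rewrite exprMn; exact: hc.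
move=> /(ler_wpM2l (_ : 0 <= U * geosum s.+1)) h.
have : 0 <= U * geosum s.+1 by rewrite mulr_ge0 ?geosum_ge0// ltW.
by move=> /h; lra.
Qed.

(** A window whose reachability Gramian exceeds [U ^+ 2] does not get it from
    its last control alone, so the last state matrix is invertible and the
    shortened window is still controllable. *)
Lemma ctrb_shorten k s g : U ^+ 2 < g -> ctrb_ge k s.+1 g ->
  (0 < s)%N /\ ctrb_ge k s (g / U ^+ 2 - 1).
Proof.
move=> gU hg.
have hA (v : 'cV[R]_nx) : (g - U ^+ 2) * enorm v ^+ 2 <=
    enorm ((ctrb A B k s)^T *m ((A (k + s))^T *m v)) ^+ 2.
  have := hg v; rewrite mul_ctrb_tr sqr_enorm_col.
  have : enorm ((B (k + s))^T *m v) ^+ 2 <= U ^+ 2 * enorm v ^+ 2.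
    by rewrite -exprMn ler_sqr ?nnegrE ?mulr_ge0 ?enorm_ge0// ltW.
  by lra.
have gU' : 0 < g - U ^+ 2 by rewrite subr_gt0.
have inj (v : 'cV[R]_nx) : (ctrb A B k s)^T *m ((A (k + s))^T *m v) = 0 -> v = 0.
  move=> h; apply: enorm_eq0; apply/eqP; rewrite -sqrf_eq0.
  have := hA v; rewrite h enorm0 expr0n pmulr_rle0// => h'.
  by rewrite eq_le h' sqr_ge0.
split.
  case: s inj {hA hg} => // inj.
  have : (const_mx 1 : 'cV[R]_nx) = 0 by apply: inj; rewrite trmx0 mul0mx.
  move/matrixP => /(_ (Ordinal hnx) 0); rewrite !mxE => /eqP.
  by rewrite oner_eq0.
have uA : (A (k + s))^T \in unitmx.
  by apply: unitmx_inj => v Av; apply: inj; rewrite Av mulmx0.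
move=> w; pose v := invmx (A (k + s))^T *m w.
have -> : w = (A (k + s))^T *m v by rewrite /v mulmxA mulmxV// mul1mx.
apply: le_trans (hA v); rewrite -[leRHS]mul1r.
have -> : g / U ^+ 2 - 1 = (g - U ^+ 2) / U ^+ 2.
  by field; rewrite gt_eqF.
rewrite mul1r -mulrA ler_pM2l// mulrC ler_pdivrMr ?exprn_gt0//.
rewrite mulrC -exprMn ler_sqr ?nnegrE ?mulr_ge0 ?enorm_ge0// ltW//.
Qed.


Variables (gC : R) (t : nat).
Hypothesis gC0 : 0 < gC.

Let E : R := U ^+ t.+1 / (U - 1).
Let mu : R := Num.sqrt (Num.min 1 gC).

(** The square of this constant is [9 / 4] divided by [gamma_G gC U t]. *)
Definition adjoint_const : R := 3 / 2 * ((1 + E / gC) * W ^+ t / mu).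

Let E_ge m s : (s + m <= t)%N -> U ^+ m.+1 * geosum s <= E.
Proof.
move=> smt; rewrite /E ler_pdivlMr ?subr_gt0// -mulrA geosum_mul.
apply: (@le_trans _ _ (U ^+ m.+1 * U ^+ s)).
  by rewrite ler_pM2l ?exprn_gt0//; lra.
by rewrite -exprD ler_weXn2l ?(ltW U1)// addSn addnC ltnS.
Qed.

Let bernoulli m : U ^+ m.+1 + m.+1%:R * U ^+ m <= W ^+ m.+1.
Proof.
elim: m => [|m IH]; first by rewrite !expr1 expr0 mulr1 addrC.
rewrite [leRHS]exprS.
have h : W * (U ^+ m.+1 + m.+1%:R * U ^+ m) <= W * W ^+ m.+1 by rewrite ler_pM2l.
apply: le_trans h; rewrite /W [U ^+ m.+2]exprS -[m.+2%:R]natr1 exprS.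
have : 0 <= m.+1%:R * U ^+ m by rewrite mulr_ge0// exprn_ge0// ltW.
by lra.
Qed.

Let mu0 : 0 < mu. Proof. by rewrite sqrtr_gt0 lt_min ltr01. Qed.
Let mu1 : mu <= 1.
Proof. by rewrite -sqrtr1 ler_sqrt// ge_min lexx. Qed.
Let E0 : 0 < E. Proof. by rewrite divr_gt0 ?exprn_gt0// subr_gt0. Qed.

Let Wmono i j : (i <= j)%N -> W ^+ i <= W ^+ j.
Proof. by move=> ij; rewrite ler_weXn2l. Qed.

Lemma adjoint_const_ge : W ^+ t <= adjoint_const.
Proof.
have w0 : 0 < W ^+ t by rewrite exprn_gt0.
have : W ^+ t <= (1 + E / gC) * W ^+ t / mu.
  rewrite ler_pdivlMr//; apply: (@le_trans _ _ (W ^+ t)).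
    by rewrite ler_piMr// ltW.
  by rewrite ler_peMl ?(ltW w0)// lerDl divr_ge0 ?ltW.
by rewrite /adjoint_const; move: w0; lra.
Qed.

(** After [m] shortenings the Gramian bound [g] has lost at most a factor
    [U ^+ 2] per step, up to an additive term, while the window lost [m] steps;
    the factor [W ^+ m] thereby saved pays for the loss. *)
Let const_ge m s g : (s.+1 + m <= t)%N -> 0 < g -> g <= 2 * U ^+ 2 ->
  gC <= U ^+ (2 * m) * (g + m%:R) -> (m = 0 /\ g = gC) \/ 1 <= g ->
  W ^+ s.+1 + U * geosum s.+1 * W ^+ s / Num.sqrt g <= adjoint_const.
Proof.
move=> smt g0 gle gCle cases.
set c := Num.sqrt g; have c0 : 0 < c by rewrite sqrtr_gt0.
have cg : c ^+ 2 = g by rewrite sqr_sqrtr// ltW.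
have w0 : 0 < W ^+ t by rewrite exprn_gt0.
have ws : W ^+ s.+1 <= W ^+ t by apply: Wmono; rewrite (leq_trans _ smt)// leq_addr.
have Es := E_ge smt.
have T0 := geosum_ge0 s.+1; set T := geosum s.+1 in Es T0 *.
suff : W ^+ t + U * T * W ^+ s / c <= adjoint_const by move: ws; lra.
have [[m0 gE]|g1] : (g <= 1 /\ (m = 0 /\ g = gC)) \/ 1 <= g.
- by have [g1|/ltW g1] := leP g 1; [case: cases => [?|]; [left|right]|right].
- move: (@gE) => [_ gE']; have muE : mu = c by rewrite /mu -gE' min_r.
  rewrite /adjoint_const muE -gE'.
  have h1 : U * T * W ^+ s <= E * W ^+ t.
    apply: ler_pM; rewrite ?exprn_ge0 ?(ltW W0)//.
    - by rewrite mulr_ge0 ?(ltW U0).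
    - apply: le_trans Es; rewrite ler_wpM2r// exprS ler_peMr ?(ltW U0)//.
      by rewrite exprn_ege1// ltW.
    - by apply: Wmono; rewrite ltnW// (leq_trans _ smt)// leq_addr.
  have h2 : E * W ^+ t <= E / g * W ^+ t.
    rewrite ler_pM2r// ler_peMr ?(ltW E0)// invf_ge1//.
  have h3 : W ^+ t * c <= W ^+ t.
    by rewrite ler_piMr ?(ltW w0)// -sqrtr1 ler_sqrt.
  rewrite mulrA ler_pdivlMr// mulrDl mulfVK ?gt_eqF//.
  have h4 : 0 <= E * W ^+ t by rewrite mulr_ge0// ltW.
  by move: h1 h2 h3 h4 w0; lra.
have c1 : 1 <= c by rewrite -sqrtr1 /c ler_wsqrtr.
have cU : c <= 3 / 2 * U.
  rewrite -ler_sqr ?nnegrE ?mulr_ge0 ?divr_ge0 ?(ltW c0) ?(ltW U0)// cg exprMn.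
  by apply: le_trans gle _; have := sqr_ge0 U; lra.
have um0 : 0 < U ^+ m by rewrite exprn_gt0.
have h1 : U ^+ m * (g + m%:R) <= 3 / 2 * (c * W ^+ m.+1).
  have b : c * (U ^+ m.+1 + m.+1%:R * U ^+ m) <= c * W ^+ m.+1 by rewrite ler_pM2l.
  have d : c * (c * U ^+ m) <= c * (3 / 2 * U ^+ m.+1).
    rewrite ler_pM2l// exprS.
    have : c * U ^+ m <= 3 / 2 * U * U ^+ m by rewrite ler_pM2r.
    by lra.
  have e : 1 * (m%:R * U ^+ m) <= c * (m%:R * U ^+ m).
    by rewrite ler_wpM2r// mulr_ge0// ltW.
  have f : 0 <= c * U ^+ m by rewrite mulr_ge0 ?ltW.
  have k : 0 <= c * (m%:R * U ^+ m) by rewrite mulr_ge0 ?(ltW c0)// mulr_ge0// ltW.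
  rewrite -cg -[m.+1%:R]natr1 in b *.
  by move: b d e f k; rewrite expr2; lra.
have h2 : U * T * gC <= 3 / 2 * (c * (E * W ^+ m.+1)).
  have a : U * T * gC <= U * T * (U ^+ m * (U ^+ m * (g + m%:R))).
    rewrite ler_wpM2l ?mulr_ge0 ?(ltW U0)//.
    by apply: le_trans gCle _; rewrite mul2n -addnn exprD mulrA.
  have b : U * T * U ^+ m * (U ^+ m * (g + m%:R)) <= E * (3 / 2 * (c * W ^+ m.+1)).
    apply: ler_pM => //; first by rewrite !mulr_ge0 ?(ltW U0) ?(ltW um0).
    - by rewrite mulr_ge0 ?addr_ge0 ?(ltW um0) ?(ltW g0).
    - by move: Es; rewrite exprS; lra.
  by move: a b; lra.
have h3 : U * T * W ^+ s / c <= 3 / 2 * (E / gC * W ^+ t).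
  rewrite ler_pdivrMr// -(ler_pM2r gC0).
  have -> : 3 / 2 * (E / gC * W ^+ t) * c * gC = 3 / 2 * (E * W ^+ t * c).
    by field; rewrite gt_eqF.
  have a : U * T * gC * W ^+ s <= 3 / 2 * (c * (E * W ^+ m.+1)) * W ^+ s.
    by rewrite ler_wpM2r// exprn_ge0// ltW.
  have b : c * E * (W ^+ m.+1 * W ^+ s) <= c * E * W ^+ t.
    rewrite -exprD (ler_pM2l (mulr_gt0 c0 E0)); apply: Wmono.
    by rewrite addSn addnC -addSn.
  by move: a b; lra.
have h4 : (1 + E / gC) * W ^+ t <= (1 + E / gC) * W ^+ t / mu.
  rewrite ler_pdivlMr// ler_piMr// mulr_ge0 ?(ltW w0)// addr_ge0// divr_ge0// ltW//.
by rewrite /adjoint_const; move: h3 h4 w0; lra.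
Qed.

(** Windows are shortened as long as the Gramian bound exceeds [2 * U ^+ 2], which
    keeps it at least 1. Below this threshold its square root is at most
    [3 / 2 * U], whence the factor [3 / 2] in [adjoint_const]. *)
Lemma block_exists k s : (s.+1 <= t)%N -> ctrb_ge k s.+1 gC ->
  exists2 s', (1 <= s' <= t)%N & wnorm q2 k s' <= adjoint_const * wnorm rho k s'.
Proof.
move=> st hs.
suff gen m g : (s.+1 + m <= t)%N -> 0 < g -> ctrb_ge k s.+1 g ->
  gC <= U ^+ (2 * m) * (g + m%:R) -> (m = 0 /\ g = gC) \/ 1 <= g ->
  exists2 s', (1 <= s' <= t)%N & wnorm q2 k s' <= adjoint_const * wnorm rho k s'.
  apply: (gen 0 gC) => //; first by rewrite addn0.
    by rewrite muln0 expr0 mul1r addr0.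
  by left.
elim: s m g {st hs} => [|s IH] m g smt g0 hg gCle cases;
  have [gle|gU] := leP g (2 * U ^+ 2).
- exists 1; first by rewrite (leq_trans _ smt)// leq_addr.
  apply: le_trans (block_le (c := Num.sqrt g) _ _) _.
  + by rewrite sqrtr_gt0.
  + by rewrite sqr_sqrtr// ltW.
  + by rewrite ler_wpM2r ?wnorm_ge0// (const_ge smt).
- have gU' : U ^+ 2 < g by have := sqr_ge0 U; lra.
  by have [] := ctrb_shorten gU' hg.
- exists s.+2; first by rewrite (leq_trans _ smt)// leq_addr.
  apply: le_trans (block_le (c := Num.sqrt g) _ _) _.
  + by rewrite sqrtr_gt0.
  + by rewrite sqr_sqrtr// ltW.
  + by rewrite ler_wpM2r ?wnorm_ge0// (const_ge smt).
- have gU' : U ^+ 2 < g by have := sqr_ge0 U; lra.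
  have [_ hg'] := ctrb_shorten gU' hg.
  have u2 : 0 < U ^+ 2 by rewrite exprn_gt0.
  have g1 : 1 <= g / U ^+ 2 - 1.
    have : 2 <= g / U ^+ 2 by rewrite ler_pdivlMr// ltW.
    by lra.
  apply: (IH m.+1 (g / U ^+ 2 - 1)) => //.
  + by rewrite addnS -addSn.
  + exact: lt_le_trans ltr01 g1.
  + apply: le_trans gCle _.
    have -> : U ^+ (2 * m.+1) = U ^+ (2 * m) * U ^+ 2 by rewrite mulnS addnC exprD.
    rewrite -mulrA ler_pM2l ?exprn_gt0//.
    rewrite -[m.+1%:R]natr1 mulrDr mulrBr mulrCA divff ?gt_eqF// mulr1.
    have : 1 * m%:R <= U ^+ 2 * m%:R by rewrite ler_wpM2r// exprn_ege1// ltW.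
    by lra.
  + by right.
Qed.

(** Disjoint controllable windows are concatenated; on the last incomplete one
    the recursion starts from the residual [q N] itself. *)
Lemma adjoint_le N :
  (forall k, (k + t <= N)%N -> exists2 s, (1 <= s <= t)%N & ctrb_ge k s gC) ->
  \sum_(0 <= j < N) q2 j + q2 N <=
  adjoint_const ^+ 2 * (\sum_(0 <= j < N) rho j + q2 N).
Proof.
move=> hC.
suff gen : forall n k, (N - k <= n)%N -> (k <= N)%N ->
  \sum_(k <= j < N) q2 j + q2 N <=
  adjoint_const ^+ 2 * (\sum_(k <= j < N) rho j + q2 N).
  by apply: (gen N) => //; rewrite subn0.
have K0 : W ^+ t <= adjoint_const := adjoint_const_ge.
have Kp : 0 <= adjoint_const by apply: le_trans K0; rewrite exprn_ge0// ltW.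
have last k : (k <= N)%N -> (N < k + t)%N ->
  \sum_(k <= j < N) q2 j + q2 N <=
  adjoint_const ^+ 2 * (\sum_(k <= j < N) rho j + q2 N).
  move=> kN Nk; have [s Ns] : exists s, N = (k + s)%N.
    by exists (N - k)%N; rewrite subnKC.
  have st : (s < t)%N by move: Nk; rewrite Ns ltn_add2l.
  have r2 : wnorm rho k s ^+ 2 = \sum_(k <= j < N) rho j.
    by rewrite sqr_wnorm -?Ns//; exact: rho_ge0.
  have w2 : wnorm q2 k s ^+ 2 = \sum_(k <= j < N) q2 j by rewrite sqr_wnorm -?Ns.
  have := window_le k s; rewrite -Ns -w2 -r2.
  move: (wnorm_ge0 rho k s) (wnorm_ge0 q2 k s) (enorm_ge0 (q N)).
  rewrite /q2; set r := wnorm rho k s; set Q := wnorm _ k s; set y := enorm (q N).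
  move=> r0 Q0 y0 hQ.
  have gs := geosum_le s; rewrite geosumS in gs.
  have gy : (1 + U * geosum s) * y <= W ^+ s * y by rewrite ler_wpM2r.
  have sum : Q + y <= W ^+ s * (r + y) by move: hQ gy; lra.
  have ws : W * W ^+ s <= adjoint_const by rewrite -exprS (le_trans _ K0)// Wmono.
  have w0 : 0 <= W ^+ s by rewrite exprn_ge0// ltW.
  have ws2 : W ^+ s * 2 <= adjoint_const.
    by apply: le_trans ws; rewrite [leLHS]mulrC ler_wpM2r.
  have sq : (Q + y) ^+ 2 <= (W ^+ s * (r + y)) ^+ 2.
    by rewrite ler_sqr ?nnegrE ?mulr_ge0 ?addr_ge0.
  have sq2 : (W ^+ s * 2) ^+ 2 <= adjoint_const ^+ 2.
    by rewrite ler_sqr ?nnegrE ?(mulr_ge0 w0 (ler0n _ 2)).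
  have sq3 : (W ^+ s * 2) ^+ 2 * (r ^+ 2 + y ^+ 2) <=
      adjoint_const ^+ 2 * (r ^+ 2 + y ^+ 2).
    by rewrite ler_wpM2r// addr_ge0 ?sqr_ge0.
  apply: le_trans sq3; have : 0 <= Q * y by rewrite mulr_ge0.
  have : 0 <= (W ^+ s) ^+ 2 * ((r - y) ^+ 2 + 2 * (r ^+ 2 + y ^+ 2)).
    apply: mulr_ge0; first exact: sqr_ge0.
    by rewrite addr_ge0 ?sqr_ge0// mulr_ge0// addr_ge0 ?sqr_ge0.
  move: sq; rewrite !exprMn !expr2.
  by lra.
elim=> [|n IH] k Nkn kN.
  apply: last => //; move: Nkn; rewrite leqn0 subn_eq0 => Nk.
  have [|Nt] := leqP (k + t) N; last by [].
  move=> ktN; have [s /andP[s1 st] _] := hC _ ktN.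
  have : (k + t <= k)%N by rewrite (leq_trans ktN).
  rewrite -{2}[k]addn0 leq_add2l leqn0 => /eqP t0.
  by move: (leq_trans s1 st); rewrite t0.
have [ktN|] := leqP (k + t) N; last exact: last.
have [s0 /andP[s1 st] hs] := hC _ ktN.
case: s0 s1 st hs => // s0 _ st hs.
have [s' /andP[s1' st'] hs'] := block_exists st hs.
have ksN : (k + s' <= N)%N by rewrite (leq_trans _ ktN)// leq_add2l.
have := IH (k + s')%N; rewrite subnDA => /(_ _ ksN) {}IH.
have {}IH := IH _; rewrite !(@big_cat_nat _ _ _ (k + s') k N) ?leq_addr//=.
have b : \sum_(k <= j < k + s') q2 j <=
    adjoint_const ^+ 2 * \sum_(k <= j < k + s') rho j.
  rewrite -!sqr_wnorm//; last exact: rho_ge0.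
  by rewrite -exprMn ler_sqr ?nnegrE ?(mulr_ge0 Kp) ?wnorm_ge0.
have : (N - k - s' <= n)%N.
  by rewrite leq_subLR (leq_trans Nkn)// -add1n leq_add2r.
by move=> /IH; move: b; lra.
Qed.

Lemma sqr_adjoint_const : adjoint_const ^+ 2 = 9 / 4 / gamma_G gC U t.
Proof.
rewrite /adjoint_const /gamma_G -/E /mu !exprMn !exprVn sqr_sqrtr; last first.
  by rewrite le_min ler01 ltW.
rewrite mulnC exprM -/W.
have m0 : Num.min 1 gC != 0 by rewrite gt_eqF// lt_min ltr01.
have gE0 : gC + E != 0 by rewrite gt_eqF// addr_gt0.
have w0 : (W ^+ t) ^+ 2 != 0 by rewrite gt_eqF// !exprn_gt0.
have wt0 : W ^+ t != 0 by rewrite gt_eqF// !exprn_gt0.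
by field; rewrite m0 gE0 wt0 gt_eqF.
Qed.

End Controllability.

Lemma gamma_G_gt0 (R : realType) (U gC : R) t :
  1 < U -> 0 < gC -> 0 < gamma_G gC U t.
Proof.
move=> U1 gC0; have U0 : 0 < U := lt_trans ltr01 U1.
have E0 : 0 < U ^+ t.+1 / (U - 1) by rewrite divr_gt0 ?exprn_gt0// subr_gt0.
rewrite /gamma_G; apply: mulr_gt0.
  by rewrite exprn_gt0// divr_gt0// addr_gt0.
by rewrite divr_gt0 ?exprn_gt0 ?addr_gt0// lt_min ltr01.
Qed.

Lemma gamma_G_le1 (R : realType) (U gC : R) t :
  1 < U -> 0 < gC -> gamma_G gC U t <= 1.
Proof.
move=> U1 gC0; have U0 : 0 < U := lt_trans ltr01 U1.
have E0 : 0 < U ^+ t.+1 / (U - 1) by rewrite divr_gt0 ?exprn_gt0// subr_gt0.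
rewrite /gamma_G -[leRHS]mulr1; apply: ler_pM.
- by rewrite sqr_ge0.
- by rewrite divr_ge0 ?exprn_ge0 ?addr_ge0 ?(ltW U0)// le_min ler01 ltW.
- rewrite exprn_ile1 ?divr_ge0 ?addr_ge0 ?(ltW gC0) ?(ltW E0)//.
  by rewrite ler_pdivrMr ?addr_gt0// mul1r lerDl ltW.
rewrite ler_pdivrMr ?exprn_gt0 ?addr_gt0// mul1r ge_min exprn_ege1//.
by rewrite lerDl ltW.
Qed.

(** * The quadratic model of the merit function *)

Section Model.
Context {R : realType} {n m : nat}.
Variables eta1 eta2 : R.
Hypothesis eta1_gt0 : 0 < eta1.
Hypothesis eta2_gt0 : 0 < eta2.
Implicit Types u v w : 'cV[R]_(n + m).

(** The merit function adds half of the square of the gradient, for this inner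
    product, to the Lagrangian. *)
Definition wdot u v : R :=
  eta2 * dot (usubmx u) (usubmx v) + eta1 * dot (dsubmx u) (dsubmx v).

Lemma wdotC u v : wdot u v = wdot v u.
Proof. by rewrite /wdot (dotC (usubmx u)) (dotC (dsubmx u)). Qed.

Lemma wdotDr u v w : wdot u (v + w) = wdot u v + wdot u w.
Proof. by rewrite /wdot !linearD /= !dotDr; ring. Qed.

Lemma wdotNr u v : wdot u (- v) = - wdot u v.
Proof. by rewrite /wdot !linearN /= !dotNr; ring. Qed.

Lemma wdotDl u v w : wdot (u + v) w = wdot u w + wdot v w.
Proof. by rewrite wdotC wdotDr !(wdotC w). Qed.

Lemma wdotNl u v : wdot (- u) v = - wdot u v.
Proof. by rewrite wdotC wdotNr wdotC. Qed.

Lemma enorm_usub v : enorm (usubmx v) <= enorm v.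
Proof. by rewrite -{2}[v]vsubmxK enorm_colL. Qed.

Lemma enorm_dsub v : enorm (dsubmx v) <= enorm v.
Proof. by rewrite -{2}[v]vsubmxK enorm_colR. Qed.

Lemma wdot_le u v : `|wdot u v| <= (eta1 + eta2) * (enorm u * enorm v).
Proof.
have h1 : `|dot (usubmx u) (usubmx v)| <= enorm u * enorm v.
  by apply: le_trans (dot_le _ _) _; rewrite ler_pM ?enorm_ge0 ?enorm_usub.
have h2 : `|dot (dsubmx u) (dsubmx v)| <= enorm u * enorm v.
  by apply: le_trans (dot_le _ _) _; rewrite ler_pM ?enorm_ge0 ?enorm_dsub.
apply: le_trans (ler_normD _ _) _; rewrite !normrM.
rewrite (gtr0_norm eta1_gt0) (gtr0_norm eta2_gt0) mulrDl addrC.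
by rewrite lerD// ler_pM2l.
Qed.

Variable K : 'M[R]_(n + m).
Hypothesis K_sym : K^T = K.

(** The form [K + K E K] with [E] the weight matrix of [wdot]. When [K] is the
    Hessian of the Lagrangian at a stationary point, it is the Hessian of the
    merit function there. *)
Definition bil u v : R := dot u (K *m v) + wdot (K *m u) (K *m v).

Lemma bilC u v : bil u v = bil v u.
Proof. by rewrite /bil dot_mul K_sym dotC wdotC. Qed.

Lemma bilDr u v w : bil u (v + w) = bil u v + bil u w.
Proof. by rewrite /bil !mulmxDr dotDr wdotDr; ring. Qed.

Lemma bilDl u v w : bil (u + v) w = bil u w + bil v w.
Proof. by rewrite bilC bilDr !(bilC w). Qed.

(** To second order a step [d] changes the merit function by
    [- bil Delta d + bil d d / 2], with slope [- bil Delta d], where [Delta] is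
    the Newton direction. For [d = Delta] the unit step thus gains half the
    predicted decrease, more than the fraction [beta < 1 / 2]; the margin
    absorbs the relative error [delta] of [d] and the remainders [eps]. *)
Lemma unit_step_decrease (M : 'M[R]_(n + m)) (Delta d g g1 : 'cV[R]_(n + m))
    (F0 F1 kappa eps delta beta c b : R) :
  0 <= kappa -> (forall v, enorm (K *m v) <= kappa * enorm v) ->
  0 <= eps <= 1 -> (forall v, enorm ((M - K) *m v) <= eps * enorm v) ->
  0 <= delta <= 1 -> 0 < beta < 1 / 2 ->
  g = - (K *m Delta) -> enorm (d - Delta) <= delta * enorm Delta ->
  enorm (g1 - g - M *m d) <= eps * enorm d ->
  `|F1 - F0 - dot g d - dot d (M *m d) / 2| <= eps * enorm d ^+ 2 ->
  c * enorm Delta ^+ 2 <= bil Delta Delta ->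
  0 <= b -> (forall u v, `|bil u v| <= b * (enorm u * enorm v)) ->
  (6 + (14 * kappa + 8) * (eta1 + eta2)) * eps + (beta + delta / 2) * delta * b
    <= (1 / 2 - beta) * c ->
  F1 + wdot g1 g1 / 2 <=
  F0 + wdot g g / 2 + beta * (dot g d + wdot g (M *m d)).
Proof.
move=> k0 Kle /andP[e0 e1] MK /andP[d0 d1] /andP[b0 b2] gE dD hg hF hc bb hb small.
set h := eta1 + eta2 in small.
have h0 : 0 <= h by rewrite addr_ge0// ltW.
set e := d - Delta in dD; have dE : d = Delta + e by rewrite /e addrC subrK.
clearbody e.
set x := enorm Delta in dD hc *; have x0 : 0 <= x by exact: enorm_ge0.
have dx : enorm d <= 2 * x.
  rewrite dE; apply: le_trans (enormD _ _) _.
  have : delta * x <= 1 * x by rewrite ler_wpM2r.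
  by move: dD; rewrite -/x; lra.
have gx : enorm g <= kappa * x by rewrite gE enormN Kle.
have Kd : enorm (K *m d) <= 2 * kappa * x.
  apply: le_trans (Kle _) _; have := ler_wpM2l k0 dx; lra.
have MKd : enorm ((M - K) *m d) <= 2 * eps * x.
  apply: le_trans (MK _) _; have := ler_wpM2l e0 dx; lra.
have ed : eps * enorm d <= 2 * eps * x by have := ler_wpM2l e0 dx; lra.
have d2 : enorm d ^+ 2 <= 4 * x ^+ 2.
  have : enorm d ^+ 2 <= (2 * x) ^+ 2.
    by rewrite ler_sqr ?nnegrE ?mulr_ge0 ?enorm_ge0.
  by rewrite exprMn; lra.
pose r := g1 - g - K *m d.
have rle : enorm r <= 4 * eps * x.
  have -> : r = (g1 - g - M *m d) + (M - K) *m d.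
    by rewrite /r mulmxBl addrA subrK.
  by apply: le_trans (enormD _ _) _; lra.
have g1E : g1 = g + K *m d + r.
  by rewrite /r; move: (K *m d) => y; apply/matrixP => i j; rewrite !mxE; ring.
clearbody r.
have x2 : 0 <= x ^+ 2 := sqr_ge0 x.
have E1 : F1 - F0 - dot g d - dot d (K *m d) / 2 <= 6 * eps * x ^+ 2.
  have a1 : dot d ((M - K) *m d) <= 2 * x * (2 * eps * x).
    by apply: le_trans (dot_ler _ _) _; rewrite ler_pM ?enorm_ge0.
  rewrite mulmxBl dotBr in a1.
  have a2 := le_trans (ler_norm _) hF.
  have a3 : eps * enorm d ^+ 2 <= eps * (4 * x ^+ 2) by rewrite ler_wpM2l.
  by move: a1 a2 a3; rewrite !expr2; lra.
have gKd : enorm (g + K *m d) <= 3 * kappa * x.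
  by apply: le_trans (enormD _ _) _; lra.
have E2 : wdot (g + K *m d) r <= 12 * h * kappa * eps * x ^+ 2.
  apply: le_trans (le_trans (ler_norm _) (wdot_le _ _)) _; rewrite -/h.
  have : enorm (g + K *m d) * enorm r <= (3 * kappa * x) * (4 * eps * x).
    by rewrite ler_pM ?enorm_ge0.
  by move=> /(ler_wpM2l h0); rewrite expr2; lra.
have E3 : wdot r r <= 16 * h * eps * x ^+ 2.
  apply: le_trans (le_trans (ler_norm _) (wdot_le _ _)) _; rewrite -/h.
  have : enorm r * enorm r <= (4 * eps * x) * (4 * eps * x).
    by rewrite ler_pM ?enorm_ge0.
  have : h * (eps * (eps * x ^+ 2)) <= h * (1 * (eps * x ^+ 2)).
    by rewrite ler_wpM2l// ler_wpM2r// mulr_ge0.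
  by move=> a /(ler_wpM2l h0); move: a; rewrite !expr2; lra.
have E4 : - wdot g ((M - K) *m d) <= 2 * h * kappa * eps * x ^+ 2.
  apply: le_trans (le_trans (ler_norm _) _)
    (_ : h * ((kappa * x) * (2 * eps * x)) <= _); last first.
    by rewrite expr2; lra.
  rewrite normrN; apply: le_trans (wdot_le _ _) _; rewrite -/h.
  by rewrite ler_wpM2l// ler_pM ?enorm_ge0.
have E5 : wdot g (M *m d) = wdot g (K *m d) + wdot g ((M - K) *m d).
  by rewrite -wdotDr mulmxBl addrC subrK.
have slope : dot g d + wdot g (K *m d) = - bil Delta d.
  by rewrite /bil gE dotNl wdotNl dot_mul K_sym; ring.
have quad : dot d (K *m d) + wdot (K *m d) (K *m d) = bil d d by [].
have Dd : bil Delta d = bil Delta Delta + bil Delta e by rewrite dE bilDr.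
have dd : bil d d = bil Delta Delta + 2 * bil Delta e + bil e e.
  rewrite dE bilDr !bilDl; rewrite (bilC e Delta); ring.
have be1 : bil Delta e <= b * delta * x ^+ 2.
  apply: le_trans (le_trans (ler_norm _) (hb _ _)) _; rewrite -/x.
  have : x * enorm e <= x * (delta * x) by rewrite ler_wpM2l.
  by move=> /(ler_wpM2l bb); rewrite expr2; lra.
have be2 : bil e e <= b * delta ^+ 2 * x ^+ 2.
  apply: le_trans (le_trans (ler_norm _) (hb _ _)) _; rewrite -/x.
  have : enorm e * enorm e <= (delta * x) * (delta * x).
    by rewrite ler_pM ?enorm_ge0.
  by move=> /(ler_wpM2l bb); rewrite !expr2; lra.
have sm : ((6 + (14 * kappa + 8) * h) * eps
    + (beta + delta / 2) * delta * b) * x ^+ 2 <=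
    (1 / 2 - beta) * c * x ^+ 2 by rewrite ler_wpM2r.
have hc' : (1 / 2 - beta) * (c * x ^+ 2) <= (1 / 2 - beta) * bil Delta Delta.
  by rewrite ler_wpM2l// subr_ge0 ltW.
have be1' := ler_wpM2l (ltW b0) be1.
have E4' : - (beta * wdot g ((M - K) *m d)) <= 2 * h * kappa * eps * x ^+ 2.
  have a : 0 <= 2 * h * kappa * eps * x ^+ 2 by rewrite !mulr_ge0.
  have : beta * - wdot g ((M - K) *m d) <= beta * (2 * h * kappa * eps * x ^+ 2).
    by rewrite ler_wpM2l// ltW.
  have : beta * (2 * h * kappa * eps * x ^+ 2) <= 1 * (2 * h * kappa * eps * x ^+ 2).
    by rewrite ler_wpM2r//; lra.
  by lra.
have wE : wdot g1 g1 = wdot g g + 2 * wdot g (K *m d) + wdot (K *m d) (K *m d)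
   + 2 * wdot (g + K *m d) r + wdot r r.
  rewrite g1E !(wdotDl, wdotDr) (wdotC (K *m d) g) (wdotC r g).
  by rewrite (wdotC r (K *m d)); ring.
rewrite wE E5.
have bs : beta * (dot g d + wdot g (K *m d)) = - beta * bil Delta d.
  by rewrite slope; ring.
rewrite Dd in slope bs; rewrite dd in quad.
set BDD := bil Delta Delta in hc' slope quad bs.
set BDe := bil Delta e in be1' slope quad bs.
set Bee := bil e e in be2 quad.
move: E1 E2 E3 E4' slope bs quad be1' be2 sm hc'.
by rewrite !expr2; lra.
Qed.

End Model.

(** * Curvature of the quadratic model for saddle-point matrices *)

Section SaddleMatrix.
Context {R : realType} {n m : nat}.
Variables (eta1 eta2 : R) (H : 'M[R]_n) (G : 'M[R]_(m, n)) (Y : R).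
Hypothesis eta1_gt0 : 0 < eta1.
Hypothesis eta2_gt0 : 0 < eta2.
Hypothesis Hle : forall p, enorm (H *m p) <= Y * enorm p.
Hypothesis Gle : forall p, enorm (G *m p) <= Y * enorm p.
Hypothesis Y_ge1 : 1 <= Y.

Let Y0 : 0 < Y. Proof. exact: lt_le_trans ltr01 Y_ge1. Qed.
Let K := block_mx H G^T G (0 : 'M[R]_m).

Let GTle q : enorm (G^T *m q) <= Y * enorm q.
Proof. by apply: mul_tr_le; [exact: ltW|exact: Gle]. Qed.

Lemma usub_saddle (w : 'cV[R]_(n + m)) :
  usubmx (K *m w) = H *m usubmx w + G^T *m dsubmx w.
Proof. by rewrite -{1}[w]vsubmxK mul_block_col col_mxKu. Qed.

Lemma dsub_saddle (w : 'cV[R]_(n + m)) : dsubmx (K *m w) = G *m usubmx w.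
Proof. by rewrite -{1}[w]vsubmxK mul_block_col col_mxKd mul0mx addr0. Qed.

Lemma usub_saddle_le (w : 'cV[R]_(n + m)) :
  enorm (usubmx (K *m w)) <= 2 * Y * enorm w.
Proof.
rewrite usub_saddle; apply: le_trans (enormD _ _) _.
have a := le_trans (Hle (usubmx w)) (ler_wpM2l (ltW Y0) (enorm_usub w)).
have b := le_trans (GTle (dsubmx w)) (ler_wpM2l (ltW Y0) (enorm_dsub w)).
by lra.
Qed.

Lemma dsub_saddle_le (w : 'cV[R]_(n + m)) : enorm (dsubmx (K *m w)) <= Y * enorm w.
Proof.
rewrite dsub_saddle.
exact: le_trans (Gle (usubmx w)) (ler_wpM2l (ltW Y0) (enorm_usub w)).
Qed.

Lemma saddle_le (w : 'cV[R]_(n + m)) : enorm (K *m w) <= 3 * Y * enorm w.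
Proof.
rewrite -[K *m w]vsubmxK; apply: le_trans (enorm_col_le _ _) _.
by have := usub_saddle_le w; have := dsub_saddle_le w; lra.
Qed.

Lemma bil_saddle_le (u v : 'cV[R]_(n + m)) : `|bil eta1 eta2 K u v| <=
  (3 * Y + 4 * eta2 * Y ^+ 2 + eta1 * Y ^+ 2) * (enorm u * enorm v).
Proof.
rewrite /bil /wdot; apply: le_trans (ler_normD _ _) _.
have h1 : `|dot u (K *m v)| <= 3 * Y * (enorm u * enorm v).
  apply: le_trans (dot_le _ _) _.
  by have := ler_wpM2l (enorm_ge0 u) (saddle_le v); lra.
have h2 : `|dot (usubmx (K *m u)) (usubmx (K *m v))| <=
    (2 * Y * enorm u) * (2 * Y * enorm v).
  apply: le_trans (dot_le _ _) _.
  by rewrite ler_pM ?enorm_ge0// usub_saddle_le.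
have h3 : `|dot (dsubmx (K *m u)) (dsubmx (K *m v))| <=
    (Y * enorm u) * (Y * enorm v).
  apply: le_trans (dot_le _ _) _.
  by rewrite ler_pM ?enorm_ge0// dsub_saddle_le.
have := ler_normD (eta2 * dot (usubmx (K *m u)) (usubmx (K *m v)))
  (eta1 * dot (dsubmx (K *m u)) (dsubmx (K *m v))).
rewrite !normrM (gtr0_norm eta1_gt0) (gtr0_norm eta2_gt0).
have := ler_wpM2l (ltW eta2_gt0) h2; have := ler_wpM2l (ltW eta1_gt0) h3.
by rewrite expr2; move: h1; lra.
Qed.

Variables (gRH s : R).
Hypothesis gRH_gt0 : 0 < gRH.
Hypothesis gRH_le : gRH <= Y.
Hypothesis s_gt0 : 0 < s.
Hypothesis s_le1 : s <= 1.
Hypothesis reduced_H : forall p, G *m p = 0 -> gRH * enorm p ^+ 2 <= dot p (H *m p).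
Hypothesis GT_ge : forall q, s * enorm q ^+ 2 <= enorm (G^T *m q) ^+ 2.

Let GGT_unit : G *m G^T \in unitmx.
Proof.
apply: unitmx_inj => y; rewrite -mulmxA => h.
have : enorm (G^T *m y) ^+ 2 = 0 by rewrite sqr_enorm -dot_mul h dot0r.
move=> h'; have := GT_ge y; rewrite h' pmulr_rle0// => y0.
by apply: enorm_eq0; apply/eqP; rewrite -sqrf_eq0 eq_le y0 sqr_ge0.
Qed.

(** The second part is [G^T *m y] with [y] the least squares multiplier. *)
Let row_space_split (p : 'cV[R]_n) : exists u v,
  [/\ p = u + v, G *m u = 0, dot u v = 0 & s * enorm v ^+ 2 <= enorm (G *m v) ^+ 2].
Proof.
pose y := invmx (G *m G^T) *m (G *m p); pose v := G^T *m y.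
have Gv : G *m v = G *m p by rewrite /v /y 2!mulmxA mulmxV// mul1mx.
exists (p - v), v; split.
- by rewrite subrK.
- by rewrite mulmxBr Gv subrr.
- by rewrite {2}/v dot_mul trmxK mulmxBr Gv subrr dot0l.
have [->|v0] := eqVneq v 0; first by rewrite mulmx0 !enorm0 expr0n mulr0 lexx.
have v1 := enorm_gt0 v0.
have vy : enorm v ^+ 2 <= enorm y * enorm (G *m v).
  by rewrite sqr_enorm {1}/v -dot_mul dot_ler.
have hy := GT_ge y; rewrite -/v in hy.
rewrite -(ler_pM2r (exprn_gt0 2 v1)).
have : (enorm v ^+ 2) ^+ 2 <= (enorm y * enorm (G *m v)) ^+ 2.
  by rewrite ler_sqr ?nnegrE ?mulr_ge0 ?sqr_ge0 ?enorm_ge0.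
move=> /(ler_wpM2l (ltW s_gt0)); rewrite exprMn.
have := ler_wpM2r (sqr_ge0 (enorm (G *m v))) hy.
by lra.
Qed.

Hypothesis eta2_le : eta2 * (12 * Y ^+ 2) <= gRH.
Hypothesis eta12_ge : 15 / 2 <= eta1 * (eta2 * s).

(** On the kernel of [G] the reduced Hessian dominates, on the row space the
    feasibility penalty [eta1], and the multipliers are controlled by the
    stationarity penalty [eta2]; the coupling [2 q^T G p] is shared between the
    two penalties, which forces [eta1] to be large compared with
    [1 / (eta2 * s)]. *)
Lemma bil_saddle_ge (w : 'cV[R]_(n + m)) :
  eta2 * s / 4 * enorm w ^+ 2 <= bil eta1 eta2 K w w.
Proof.
have [p [q ->]] : exists p q, w = col_mx p q.
  by exists (usubmx w), (dsubmx w); rewrite vsubmxK.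
rewrite /bil /wdot sqr_enorm_col usub_saddle dsub_saddle.
rewrite [K *m _]mul_block_col mul0mx addr0 dot_col col_mxKu col_mxKd.
rewrite (dotDr p) -!sqr_enorm.
rewrite [dot p (G^T *m q)]dot_mul trmxK (dotC (G *m p) q).
have [u [v [pE Gu uv Gv]]] := row_space_split p.
have Gp : G *m p = G *m v by rewrite pE mulmxDr Gu add0r.
have pn : enorm p ^+ 2 = enorm u ^+ 2 + enorm v ^+ 2.
  by rewrite pE sqr_enorm !(dotDl, dotDr) (dotC v u) uv !sqr_enorm; ring.
have hH : gRH * enorm u ^+ 2 - 2 * Y * (enorm u * enorm v) - Y * enorm v ^+ 2
    <= dot p (H *m p).
  rewrite pE mulmxDr !(dotDl, dotDr).
  have a := reduced_H Gu.
  have b : - dot u (H *m v) <= enorm u * (Y * enorm v).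
    rewrite -dotNl; apply: le_trans (dot_ler _ _) _.
    by rewrite enormN ler_wpM2l ?enorm_ge0.
  have c : - dot v (H *m u) <= enorm v * (Y * enorm u).
    rewrite -dotNl; apply: le_trans (dot_ler _ _) _.
    by rewrite enormN ler_wpM2l ?enorm_ge0.
  have d : - dot v (H *m v) <= enorm v * (Y * enorm v).
    rewrite -dotNl; apply: le_trans (dot_ler _ _) _.
    by rewrite enormN ler_wpM2l ?enorm_ge0.
  by rewrite expr2 in a *; rewrite expr2; lra.
have hq : - dot q (G *m p) <= enorm q * enorm (G *m p).
  by rewrite -dotNl; apply: le_trans (dot_ler _ _) _; rewrite enormN.
have hE : s * enorm q ^+ 2 / 2 - Y ^+ 2 * enorm p ^+ 2 <=
    enorm (H *m p + G^T *m q) ^+ 2.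
  have a : enorm (G^T *m q) <= enorm (H *m p + G^T *m q) + enorm (H *m p).
    have {1}-> : G^T *m q = (H *m p + G^T *m q) - H *m p by rewrite addrC addKr.
    exact: enormB_le.
  have b : enorm (H *m p) ^+ 2 <= (Y * enorm p) ^+ 2.
    by rewrite ler_sqr ?nnegrE ?mulr_ge0 ?enorm_ge0// ltW.
  have c : enorm (G^T *m q) ^+ 2 <=
      (enorm (H *m p + G^T *m q) + enorm (H *m p)) ^+ 2.
    by rewrite ler_sqr ?nnegrE ?addr_ge0 ?enorm_ge0.
  have := sqr_ge0 (enorm (H *m p + G^T *m q) - enorm (H *m p)).
  have := GT_ge q.
  by move: b c; rewrite exprMn !expr2; lra.
rewrite Gp in hq *; rewrite pn in hE *.
move: (enorm_ge0 u) (enorm_ge0 v) (enorm_ge0 q) (enorm_ge0 (G *m v)).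
move: Gv hH hq hE.
set nu := enorm u; set nv := enorm v; set nq := enorm q; set g := enorm (G *m v).
set X1 := dot p (H *m p); set X2 := dot q (G *m v); set X3 := enorm _ ^+ 2.
move=> Gv hH hq hE u0 v0 q0 g0.
(* the scale at which Young's inequality splits the coupling term *)
pose L := (eta2 * s)^-1; have es0 : 0 < eta2 * s by rewrite mulr_gt0.
have L0 : 0 < L by rewrite invr_gt0.
have LE : eta2 * s * L = 1 by rewrite mulfV ?gt_eqF.
have young : 2 * (nq * g) <= eta2 * s / 4 * nq ^+ 2 + 4 * L * g ^+ 2.
  have : 0 <= eta2 * s * (nq - 4 * L * g) ^+ 2 by rewrite mulr_ge0 ?sqr_ge0// ltW.
  have -> : eta2 * s * (nq - 4 * L * g) ^+ 2 = eta2 * s * nq ^+ 2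
     - 8 * (eta2 * s * L) * (nq * g) + 16 * (eta2 * s * L) * (L * g ^+ 2) by ring.
  by rewrite LE; lra.
have eL : 15 / 2 * L <= eta1 by rewrite ler_pdivrMr.
have eg : 15 / 2 * L * g ^+ 2 <= eta1 * g ^+ 2 by rewrite ler_wpM2r ?sqr_ge0.
pose k := Y ^+ 2 / gRH.
have Y2 : 0 < Y ^+ 2 by rewrite exprn_gt0.
have k0 : 0 < k by rewrite divr_gt0.
have kE : k * gRH = Y ^+ 2 by rewrite /k mulfVK ?gt_eqF.
have kY : Y <= k.
  by rewrite ler_pdivlMr// expr2 ler_pM2l.
have Lv : 12 * k * nv ^+ 2 <= L * g ^+ 2.
  have a : L * (s * nv ^+ 2) <= L * g ^+ 2 by rewrite ler_pM2l.
  apply: le_trans a; rewrite [L * _]mulrA ler_wpM2r ?sqr_ge0//.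
  have -> : L * s = eta2^-1 by rewrite /L; field; rewrite !gt_eqF.
  rewrite -[leRHS]mul1r ler_pdivlMr// -(ler_pM2r gRH_gt0) mul1r.
  by move: eta2_le; rewrite -kE; lra.
have uv2 : 2 * Y * (nu * nv) <= gRH / 2 * nu ^+ 2 + 2 * k * nv ^+ 2.
  have : 0 <= (gRH * nu - 2 * Y * nv) ^+ 2 / gRH.
    by rewrite divr_ge0 ?sqr_ge0// ltW.
  have -> : (gRH * nu - 2 * Y * nv) ^+ 2 / gRH =
     gRH * nu ^+ 2 - 4 * Y * (nu * nv) + 4 * k * nv ^+ 2.
    by rewrite /k; field; rewrite gt_eqF.
  by lra.
have eY : eta2 * Y ^+ 2 <= gRH / 12 by move: eta2_le; lra.
have es : eta2 * s <= gRH / 12.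
  apply: le_trans eY; rewrite ler_pM2l//; apply: le_trans s_le1 _.
  by rewrite exprn_ege1.
have u2 := sqr_ge0 nu; have v2 := sqr_ge0 nv.
have eYu := ler_wpM2r (addr_ge0 u2 v2) eY.
have esu := ler_wpM2r (addr_ge0 u2 v2) es.
have kv := ler_wpM2r v2 kY.
have gv := ler_wpM2r v2 (le_trans gRH_le kY).
have k2 : 0 <= k * nv ^+ 2 by rewrite mulr_ge0// ltW.
have gu : 0 <= gRH * nu ^+ 2 by rewrite mulr_ge0// ltW.
have hE' := ler_wpM2l (ltW eta2_gt0) hE.
by move: young eg Lv uv2 eYu esu kv gv k2 gu hE' hH hq; lra.
Qed.

End SaddleMatrix.

(** * Orthonormal bases of kernels *)

Section OrthonormalBasis.
Context {R : realType} {n : nat}.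

(** Gram-Schmidt, one column at a time; a column whose residual vanishes is
    dropped. *)
Lemma orthonormal_span q (M : 'M[R]_(n, q)) :
  exists r (Z : 'M[R]_(n, r)) (C : 'M[R]_(r, q)) (D : 'M[R]_(q, r)),
  [/\ Z^T *m Z = 1%:M, M = Z *m C & Z = M *m D].
Proof.
elim: q M => [|q IH] M.
  exists 0, 0, 0, 0; split; first by apply/matrixP => -[].
    by apply/matrixP => i -[].
  by rewrite mulmx0.
rewrite -[q.+1]/(1 + q)%N in M *.
have [r [Z [C [D [ZZ MC ZD]]]]] := IH (rsubmx M).
pose a := lsubmx M; pose b := a - Z *m (Z^T *m a).
have ME : M = row_mx a (rsubmx M) by rewrite hsubmxK.
have [b0|b0] := eqVneq b 0.
  exists r, Z, (row_mx (Z^T *m a) C), (col_mx 0 D); split=> //.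
    rewrite mul_mx_row -MC {1}ME; congr row_mx.
    by apply/eqP; rewrite -subr_eq0 -/b b0.
  by rewrite ME mul_row_col mulmx0 add0r -ZD.
have bp := enorm_gt0 b0; have bn0 : enorm b != 0 by rewrite gt_eqF.
pose c : 'cV[R]_n := (enorm b)^-1 *: b.
have Zc : Z^T *m c = 0.
  by rewrite /c -scalemxAr /b mulmxBr (mulmxA Z^T Z) ZZ mul1mx subrr scaler0.
have cc : c^T *m c = 1%:M.
  rewrite [c^T *m c]mx11_scalar -[_ 0 0]/(dot c c) -sqr_enorm /c enormZ.
  by rewrite ger0_norm ?invr_ge0 ?enorm_ge0// mulVf// expr1n.
exists (1 + r)%N, (row_mx c Z).
exists (block_mx (enorm b)%:M 0 (Z^T *m a) C).
exists (block_mx (enorm b)^-1%:M 0 (- (enorm b)^-1 *: (D *m (Z^T *m a))) D).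
split.
- rewrite tr_row_mx mul_col_row cc ZZ Zc.
  have -> : c^T *m Z = 0 by apply: trmx_inj; rewrite trmx_mul trmxK Zc trmx0.
  by rewrite -scalar_mx_block.
- rewrite mul_row_block mulmx0 add0r -MC {1}ME mul_mx_scalar; congr row_mx.
  by rewrite /c scalerA divff// scale1r subrK.
- rewrite ME mul_row_block mulmx0 add0r -ZD mul_mx_scalar; congr row_mx.
  by rewrite -scalemxAr (mulmxA (rsubmx M)) -ZD scaleNr -scalerBr.
Qed.

Lemma orthonormal_kernel m (G : 'M[R]_(m, n)) : exists r (Z : 'M[R]_(n, r)),
  Z^T *m Z = 1%:M /\
  forall w : 'cV[R]_n, G *m w = 0 <-> exists y : 'cV[R]_r, w = Z *m y.
Proof.
have [r [Z [C [D [ZZ MC ZD]]]]] := orthonormal_span (kermx G^T)^T.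
exists r, Z; split=> // w; split=> [Gw|[y ->]].
  have /sub_kermxP/submxP[y yE] : w^T *m G^T = 0 by rewrite -trmx_mul Gw trmx0.
  exists (C *m y^T); rewrite mulmxA -MC; apply: trmx_inj.
  by rewrite trmx_mul !trmxK.
have Gk : G *m (kermx G^T)^T = 0.
  by apply: trmx_inj; rewrite trmx_mul trmxK mulmx_ker trmx0.
by rewrite ZD !mulmxA Gk !mul0mx.
Qed.

Lemma kernel_exists m (G : 'M[R]_(m, n)) : (m < n)%N ->
  exists2 w : 'cV[R]_n, w != 0 & G *m w = 0.
Proof.
move=> mn; have : kermx G^T != 0.
  rewrite kermx_eq0 /row_free neq_ltn; apply/orP; left.
  by rewrite (leq_ltn_trans (rank_leq_col _)).
move=> /rowV0Pn[y /sub_kermxP yG y0]; exists y^T.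
  by rewrite trmx_eq0.
by apply: trmx_inj; rewrite trmx_mul trmxK yG trmx0.
Qed.

End OrthonormalBasis.

(** * Differential calculus on column vectors *)

Section Smooth.
Context {R : realType}.
Implicit Types V W X : normedModType R.

Lemma lin_diff V W (L : V -> W) x : linear L -> continuous L ->
  differentiable L x /\ forall v, 'D_v L x = L v.
Proof.
move=> Llin Lc.
pose LM := GRing.isLinear.Build _ _ _ _ _ Llin.
pose L' : {linear V -> W} := HB.pack L LM.
have dL : differentiable (L' : V -> W) x by apply: linear_differentiable.
split=> // v; rewrite -[L]/(L' : V -> W) deriveE//.
by rewrite diff_lin.
Qed.

Lemma linear_eq0 V W (L : V -> W) : linear L -> L 0 = 0.
Proof.
move=> Llin; have := Llin (-1) 0 0.
by rewrite scaler0 addr0 scaleN1r addNr.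
Qed.

Lemma derive_comp_lin V W X (L : V -> W) (F : W -> X) x v : linear L ->
  'D_v (fun y => F (L y)) x = 'D_(L v) F (L x).
Proof.
move=> Llin; rewrite /derive; set f := (fun h => _); set g := (fun h => _).
by suff -> : f = g by []; apply/funext => h; rewrite /f /g /= Llin.
Qed.

Lemma derive_lin_comp V W X (F : V -> W) (L : W -> X) x v :
  linear L -> continuous L -> differentiable F x ->
  'D_v (fun y => L (F y)) x = L ('D_v F x).
Proof.
move=> Llin Lc dF; have [dL LE] := lin_diff (F x) Llin Lc.
rewrite (_ : (fun _ => _) = L \o F)// deriveE; last exact: differentiable_comp.
by rewrite diff_comp//= -!deriveE// LE.
Qed.

Lemma cont_diff_continuous V W p (F : V -> W) : cont_diff p F -> continuous F.
Proof.
by case: p => [//|p] [dF _] x; exact: differentiable_continuous.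
Qed.

Lemma cont_diffS V W p (F : V -> W) : cont_diff p.+1 F -> cont_diff p F.
Proof.
elim: p F => [|p IH] F [dF DF] /=.
  by move=> x; exact: differentiable_continuous.
by split=> // v; apply: IH; exact: DF.
Qed.

Lemma cont_diff_cst V W p (a : W) : cont_diff p (fun _ : V => a).
Proof.
elim: p a => [|p IH] a /=; first by move=> x; exact: cst_continuous.
split=> [x|v]; first exact: differentiable_cst.
have -> : (fun x => 'D_v (fun _ : V => a) x) = fun _ => 0; last exact: IH.
by apply/funext => x; rewrite derive_cst.
Qed.

Lemma cont_diff_lin V W p (L : V -> W) :
  linear L -> continuous L -> cont_diff p L.
Proof.
move=> Llin Lc; case: p => [//|p] /=; split=> [x|v].
  by have [] := lin_diff x Llin Lc.
rewrite (_ : (fun x => _) = fun _ => L v); first exact: cont_diff_cst.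
by apply/funext => x; have [_ ->] := lin_diff x Llin Lc.
Qed.

Lemma cont_diffD V W p (F G : V -> W) : cont_diff p F -> cont_diff p G ->
  cont_diff p (fun x => F x + G x).
Proof.
elim: p F G => [|p IH] F G /=.
  by move=> cF cG x; apply: cvgD; [exact: cF|exact: cG].
move=> [dF DF] [dG DG]; split=> [x|v].
  exact: (differentiableD (dF x) (dG x)).
rewrite (_ : (fun x => _) = fun x => 'D_v F x + 'D_v G x).
  by apply: IH; [exact: DF|exact: DG].
by apply/funext => x; rewrite -deriveD//; exact: diff_derivable.
Qed.

Lemma cont_diff_sum V W p (I : Type) (s : seq I) (F : I -> V -> W) :
  (forall i, cont_diff p (F i)) -> cont_diff p (fun x => \sum_(i <- s) F i x).
Proof.
move=> cF; elim: s => [|i s IH].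
  rewrite (_ : (fun x => _) = fun _ => 0); first exact: cont_diff_cst.
  by apply/funext => x; rewrite big_nil.
rewrite (_ : (fun x => _) = fun x => F i x + \sum_(j <- s) F j x).
  exact: cont_diffD.
by apply/funext => x; rewrite big_cons.
Qed.

Lemma cont_diffM V p (F G : V -> R) : cont_diff p F -> cont_diff p G ->
  cont_diff p (fun x => F x * G x).
Proof.
elim: p F G => [|p IH] F G cF cG.
  by move=> x; apply: cvgM; [exact: cF|exact: cG].
have [[dF DF] [dG DG]] := (cF, cG); split=> [x|v].
  exact: (differentiableM (dF x) (dG x)).
rewrite (_ : (fun x => _) = fun x => F x * 'D_v G x + G x * 'D_v F x).
  apply: cont_diffD; apply: IH; (exact: DF || exact: DG || exact: cont_diffS).
apply/funext => x; rewrite -[LHS]/('D_v (F * G) x) deriveM//; exact: diff_derivable.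
Qed.

Lemma cont_diff_comp_lin V W X p (L : V -> W) (F : W -> X) :
  linear L -> continuous L -> cont_diff p F -> cont_diff p (fun x => F (L x)).
Proof.
move=> Llin Lc; elim: p F => [|p IH] F /=.
  by move=> cF x; apply: continuous_comp; [exact: Lc|exact: cF].
move=> [dF DF]; split=> [x|v].
  by apply: differentiable_comp => //; have [] := lin_diff x Llin Lc.
have -> : (fun x => 'D_v (fun y => F (L y)) x) = fun x => 'D_(L v) F (L x).
  by apply/funext => x; rewrite derive_comp_lin.
exact: (IH _ (DF (L v))).
Qed.

Lemma cont_diff_lin_comp V W X p (F : V -> W) (L : W -> X) :
  linear L -> continuous L -> cont_diff p F -> cont_diff p (fun x => L (F x)).
Proof.
move=> Llin Lc; elim: p F => [|p IH] F /=.
  by move=> cF x; apply: continuous_comp; [exact: cF|exact: Lc].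
move=> [dF DF]; split=> [x|v].
  by apply: differentiable_comp => //; have [] := lin_diff (F x) Llin Lc.
have -> : (fun x => 'D_v (fun y => L (F y)) x) = fun x => L ('D_v F x).
  by apply/funext => x; rewrite derive_lin_comp.
exact: (IH _ (DF v)).
Qed.

Lemma col_sumE n (v : 'cV[R]_n) : v = \sum_i v i 0 *: delta_mx i 0.
Proof.
rewrite {1}[v]matrix_sum_delta; apply: eq_bigr => i _.
by rewrite big_ord1.
Qed.

Lemma linear_col_sum n W (L : 'cV[R]_n -> W) v : linear L ->
  L v = \sum_i v i 0 *: L (delta_mx i 0).
Proof.
move=> Llin; rewrite {1}[v]col_sumE.
elim/big_rec2 : _ => [|i y1 y2 _ IH]; first exact: linear_eq0.
by rewrite Llin IH.
Qed.

Lemma linear_col_continuous n W (L : 'cV[R]_n -> W) : linear L -> continuous L.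
Proof.
move=> Llin; rewrite (_ : L = fun v => \sum_i v i 0 *: L (delta_mx i 0)); last first.
  by apply/funext => v; exact: linear_col_sum.
apply: (@cont_diff_continuous _ _ 0).
apply: cont_diff_sum => i x /=.
apply: (@continuous_comp _ _ _ (fun v : 'cV[R]_n => v i 0)
  (fun a : R => a *: L (delta_mx i 0))).
  exact: coord_continuous.
exact: scalel_continuous.
Qed.

Lemma scalel_linear W (w : W) : linear (fun a : R => a *: w).
Proof. by move=> a b c /=; rewrite scalerDl scalerA. Qed.

Lemma cont_diff_coord V n p (F : V -> 'cV[R]_n) i :
  cont_diff p F -> cont_diff p (fun x => F x i 0).
Proof.
apply: (cont_diff_lin_comp (L := fun v : 'cV[R]_n => v i 0)).
  by move=> a u v; rewrite !mxE.
exact: coord_continuous.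
Qed.

Lemma cont_diff_col V n p (F : V -> 'cV[R]_n) :
  (forall i, cont_diff p (fun x => F x i 0)) -> cont_diff p F.
Proof.
move=> cF; have -> : F = fun x => \sum_i F x i 0 *: delta_mx i 0.
  by apply/funext => x; exact: col_sumE.
apply: cont_diff_sum => i.
exact: (cont_diff_lin_comp (scalel_linear (delta_mx i 0 : 'cV[R]_n))
  (@scalel_continuous _ _ _) (cF i)).
Qed.

Lemma cont_diffN V W p (F : V -> W) :
  cont_diff p F -> cont_diff p (fun x => - F x).
Proof.
apply: (cont_diff_lin_comp (L := fun y : W => - y)).
  by move=> a u v; rewrite opprD scalerN.
by move=> x; exact: opp_continuous.
Qed.

Lemma derive_dot_grad n (phi : 'cV[R]_n -> R) x v : differentiable phi x ->
  'D_v phi x = dot (grad phi x) v.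
Proof.
move=> dphi; rewrite deriveE// dotE.
rewrite (linear_col_sum v) => [|a u w]; last by rewrite linearP.
by apply: eq_bigr => i _; rewrite mxE deriveE// mulrC.
Qed.

Lemma jac_mul n m (F : 'cV[R]_n -> 'cV[R]_m) x v : differentiable F x ->
  jac F x *m v = 'D_v F x.
Proof.
move=> dF; rewrite deriveE//.
rewrite (linear_col_sum v) => [|a u w]; last by rewrite linearP.
apply/matrixP => i j; rewrite ord1 mxE summxE; apply: eq_bigr => k _.
by rewrite !mxE deriveE// mulrC.
Qed.

Lemma cont_diff_grad n p (phi : 'cV[R]_n -> R) :
  cont_diff p.+1 phi -> cont_diff p (grad phi).
Proof.
move=> [dphi Dphi].
rewrite (_ : grad phi = fun x => \sum_i ('D_(delta_mx i 0) phi x *: delta_mx i 0)).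
  apply: cont_diff_sum => i.
  apply: (cont_diff_lin_comp (L := fun a : R => a *: (delta_mx i 0 : 'cV[R]_n))).
  - exact: scalel_linear.
  - exact: scalel_continuous.
  - exact: Dphi.
apply/funext => x; rewrite {1}[grad phi x]col_sumE.
by apply: eq_bigr => i _; rewrite mxE.
Qed.

Lemma enorm_nbhs n (x0 : 'cV[R]_n) e : 0 < e ->
  \forall x \near x0, enorm (x - x0) < e.
Proof.
move=> e0; apply/nbhs_ballP; exists (e / n.+1%:R) => /=.
  by rewrite divr_gt0.
move=> x [_ xx0]; apply: le_lt_trans (enorm_le_sum _) _.
apply: (@le_lt_trans _ _ (\sum_(i < n) e / n.+1%:R)).
  apply: ler_sum => i _; rewrite !mxE distrC ltW//; exact: xx0.
rewrite sumr_const card_ord -(mulr_natr (e / _)) mulrAC.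
by rewrite ltr_pdivrMr ?ltr0n// ltr_pM2l// ltr_nat.
Qed.

Lemma nbhs_enorm n (x0 : 'cV[R]_n) (Q : set 'cV[R]_n) : nbhs x0 Q ->
  exists2 e, 0 < e & forall x, enorm (x - x0) < e -> Q x.
Proof.
move=> /nbhs_ballP[e /= e0 Qe]; exists e => // x xe; apply: Qe; split=> // i j.
rewrite [j]ord1; apply: le_lt_trans xe; rewrite distrC.
by apply: le_trans (coord_le_enorm _ i); rewrite !mxE.
Qed.

Lemma continuous_enorm n m (F : 'cV[R]_n -> 'cV[R]_m) x0 e : continuous F ->
  0 < e -> exists2 r, 0 < r &
    forall x, enorm (x - x0) < r -> enorm (F x - F x0) < e.
Proof.
move=> cF e0; apply: (@nbhs_enorm _ _ [set x | enorm (F x - F x0) < e]).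
exact: (cF x0 _ (enorm_nbhs (F x0) e0)).
Qed.

Lemma is_derive_segment V (phi : V -> R) x v (s : R) :
  differentiable phi (x + s *: v) ->
  is_derive s 1 (fun s : R => phi (x + s *: v)) ('D_v phi (x + s *: v)).
Proof.
move=> dphi; set f := fun s => _.
have E : (fun h => h^-1 *: ((f \o shift s) (h *: 1) - f s)) =
    (fun h => h^-1 *: ((phi \o shift (x + s *: v)) (h *: v) - phi (x + s *: v))).
  apply/funext => h /=; congr (_ *: (phi _ - _)).
  by rewrite [h *: 1]mulr1 scalerDl addrCA.
split; last by rewrite /derive E.
by rewrite /derivable E; apply: diff_derivable.
Qed.

Lemma mean_value01 (f df : R -> R) : (forall s : R, is_derive s 1 f (df s)) ->
  exists2 s, 0 < s < 1 & f 1 - f 0 = df s.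
Proof.
move=> dfE; have [|c + E] := @MVT R f df 0 1 ltr01 (fun s _ => dfE s).
  apply: derivable_within_continuous => c _.
  exact: (ex_derive (is_derive := dfE c)).
by rewrite in_itv /= => c01; exists c => //; rewrite E subr0 mulr1.
Qed.

Lemma mean_value V (phi : V -> R) x v : (forall y, differentiable phi y) ->
  exists2 s, 0 < s < 1 & phi (x + v) - phi x = 'D_v phi (x + s *: v).
Proof.
move=> dphi.
have [s s01] := mean_value01 (fun s => is_derive_segment (dphi (x + s *: v))).
by rewrite scale1r scale0r addr0 => E; exists s.
Qed.

Lemma jac_near n m (F : 'cV[R]_n -> 'cV[R]_m) x0 e : cont_diff 1 F -> 0 < e ->
  exists2 r, 0 < r & forall x v, enorm (x - x0) < r ->
    enorm ((jac F x - jac F x0) *m v) <= e * enorm v.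
Proof.
move=> [dF DF] e0.
have e1 : 0 < e / n.+1%:R by rewrite divr_gt0.
pose Q := [set x : 'cV[R]_n | forall j : 'I_n,
  enorm ('D_(delta_mx j 0) F x - 'D_(delta_mx j 0) F x0) < e / n.+1%:R].
have [|r r0 hr] := @nbhs_enorm _ x0 Q.
  have near_j (j : 'I_n) : \forall x \near x0,
      enorm ('D_(delta_mx j 0) F x - 'D_(delta_mx j 0) F x0) < e / n.+1%:R.
    exact: (DF (delta_mx j 0) x0 _ (enorm_nbhs _ e1)).
  exact: (@filter_forall _ _ _ (nbhs x0) (nbhs_filter x0) near_j).
exists r => // x v /hr hx.
rewrite {1}[v]col_sumE mulmx_sumr.
have -> : e * enorm v = e / n.+1%:R * enorm v * n.+1%:R.
  by rewrite mulrAC mulfVK ?pnatr_eq0.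
have sum_le (I : Type) (s : seq I) (f : I -> 'cV[R]_m) (c : R) :
    (forall i, enorm (f i) <= c) -> enorm (\sum_(i <- s) f i) <= c *+ size s.
  move=> fc; elim: s => [|i s IH]; first by rewrite big_nil enorm0 mulr0n.
  rewrite big_cons /= mulrS; apply: le_trans (enormD _ _) _.
  exact: lerD.
apply: le_trans (sum_le _ _ _ (e / n.+1%:R * enorm v) _) _.
  move=> i; rewrite -scalemxAr mulmxBl !jac_mul// enormZ mulrC.
  apply: ler_pM; rewrite ?enorm_ge0//; last exact: coord_le_enorm.
  exact: ltW (hx i).
rewrite -[size _]/(size (index_enum 'I_n)) -(mulr_natr _ (size _)).
rewrite /index_enum -enumT size_enum_ord ler_wpM2l//.
  by rewrite mulr_ge0 ?enorm_ge0// ltW.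
by rewrite ler_nat.
Qed.

Lemma enorm_segment n (x0 x v : 'cV[R]_n) r s : 0 < s < 1 ->
  enorm (x - x0) < r -> enorm (x + v - x0) < r -> enorm (x + s *: v - x0) < r.
Proof.
move=> /andP[s0 s1] hx hv.
have -> : x + s *: v - x0 = (1 - s) *: (x - x0) + s *: (x + v - x0).
  by apply/matrixP => i j; rewrite !mxE; ring.
apply: le_lt_trans (enormD _ _) _; rewrite !enormZ.
rewrite (ger0_norm (ltW s0)) (@ger0_norm _ (1 - s)) ?subr_ge0 ?ltW//.
have s1' : 0 < 1 - s by rewrite subr_gt0.
have := hx; rewrite -(ltr_pM2l s1') => a.
have := hv; rewrite -(ltr_pM2l s0) => b.
by lra.
Qed.

(** Strict differentiability of C^1 maps. The mean value theorem, applied to the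
    component along the error itself, reduces it to the continuity of the
    Jacobian. *)
Lemma strict_diff n m (F : 'cV[R]_n -> 'cV[R]_m) x0 e : cont_diff 1 F -> 0 < e ->
  exists2 r, 0 < r & forall x v, enorm (x - x0) < r -> enorm (x + v - x0) < r ->
    enorm (F (x + v) - F x - jac F x *m v) <= e * enorm v.
Proof.
move=> cF e0; have [dF DF] := cF.
have e2 : 0 < e / 2 by rewrite divr_gt0.
have [r r0 hr] := jac_near x0 cF e2; exists r => // x v hx hv.
set u := _ - _ - _.
have [->|u0] := eqVneq u 0; first by rewrite enorm0 mulr_ge0 ?enorm_ge0// ltW.
have up := enorm_gt0 u0.
have lin_u : linear (fun w : 'cV[R]_m => dot u w).
  by move=> a w w'; rewrite dotDr dotZr.
have [|s s01 hs] := @mean_value _ (fun y => dot u (F y)) x v.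
  move=> y; apply: differentiable_comp => //.
  by have [] := lin_diff (F y) lin_u (linear_col_continuous lin_u).
rewrite derive_lin_comp// in hs; last exact: linear_col_continuous.
have hxs := enorm_segment s01 hx hv.
rewrite -jac_mul// in hs.
rewrite -(ler_pM2r up) -expr2 sqr_enorm {2}/u !dotBr hs.
have -> : dot u (jac F (x + s *: v) *m v) - dot u (jac F x *m v) =
    dot u ((jac F (x + s *: v) - jac F x0) *m v) - dot u ((jac F x - jac F x0) *m v).
  by rewrite -!dotBr -!mulmxBl opprB addrA subrK.
have split_e : enorm u * (e / 2 * enorm v) + enorm u * (e / 2 * enorm v) <=
    e * enorm v * enorm u by lra.
apply: le_trans split_e.
apply: lerD.
  by apply: le_trans (dot_ler _ _) _; rewrite ler_wpM2l ?enorm_ge0// hr.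
rewrite -dotNr; apply: le_trans (dot_ler _ _) _; rewrite enormN.
by rewrite ler_wpM2l ?enorm_ge0// hr.
Qed.

(** The error of the quadratic model along a segment has a derivative controlled
    by the strict differentiability of the gradient. *)
Lemma taylor2 n (phi : 'cV[R]_n -> R) x0 e : cont_diff 2 phi -> 0 < e ->
  exists2 r, 0 < r & forall x v, enorm (x - x0) < r -> enorm (x + v - x0) < r ->
    `|phi (x + v) - phi x - dot (grad phi x) v - dot v (hess phi x *m v) / 2|
      <= e * enorm v ^+ 2.
Proof.
move=> cphi e0; have [dphi _] := cphi.
have [r r0 hr] := strict_diff x0 (cont_diff_grad cphi) e0.
exists r => // x v hx hv.
set a := dot (grad phi x) v; set b := dot v (hess phi x *m v).
pose q : R -> R := a *: id + (b / 2) *: (id ^+ 2).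
have qE s : q s = a * s + b / 2 * s ^+ 2 by [].
have dq (s : R) : is_derive s 1 q (a + s * b).
  have i1 := is_deriveZ a (is_derive_id s 1).
  have i2 := is_deriveZ (b / 2) (is_deriveX 2 (is_derive_id s 1)).
  by apply: (is_derive_eq (is_deriveD i1 i2)); rewrite /GRing.scale /=; field.
pose f := (fun s : R => phi (x + s *: v)) - q.
have df (s : R) : is_derive s 1 f ('D_v phi (x + s *: v) - (a + s * b)).
  apply: is_deriveB; exact: is_derive_segment.
have [s s01] := mean_value01 df.
have -> : f 1 - f 0 = phi (x + v) - phi x - a - b / 2.
  rewrite -[f 1]/(_ - q 1) -[f 0]/(_ - q 0) !qE scale1r scale0r addr0.
  by rewrite expr1n expr0n /=; ring.
move=> ->; have /andP[s0 s1] := s01.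
have hxs := enorm_segment s01 hx hv.
have := hr x (s *: v) hx hxs.
rewrite derive_dot_grad// -/(hess phi x) enormZ (ger0_norm (ltW s0)).
rewrite -scalemxAr => hg.
have -> : dot (grad phi (x + s *: v)) v - (a + s * b) =
    dot (grad phi (x + s *: v) - grad phi x - s *: (hess phi x *m v)) v.
  by rewrite !dotBl dotZl (dotC (_ *m v)) /a /b; ring.
apply: le_trans (dot_le _ _) _.
apply: le_trans (ler_wpM2r (enorm_ge0 v) hg) _.
rewrite expr2 -mulrA ler_pM2l// -mulrA ler_piMl ?mulr_ge0 ?enorm_ge0// ltW//.
Qed.

End Smooth.

(** * Derivatives of the Lagrangian and of the merit function *)

Section ProductRule.
Context {R : realType} {V : normedModType R}.

Lemma differentiable_coordinate n (F : V -> 'cV[R]_n) x i :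
  differentiable F x -> differentiable (fun y => F y i 0) x.
Proof.
move=> dF.
exact: (@differentiable_comp _ _ _ _ F (fun M : 'cV[R]_n => M i 0) x dF
  (differentiable_coord (F x) i 0)).
Qed.

Lemma derive_coordinate n (F : V -> 'cV[R]_n) x v i : differentiable F x ->
  'D_v (fun y => F y i 0) x = 'D_v F x i 0.
Proof.
move=> dF; rewrite (derive_lin_comp (L := fun u : 'cV[R]_n => u i 0))//.
  by move=> a u w; rewrite !mxE.
exact: coord_continuous.
Qed.

Lemma dot_fctE n (F G : V -> 'cV[R]_n) : (fun y => dot (F y) (G y)) =
  \sum_(i < n) ((fun y => F y i 0) * (fun y => G y i 0)).
Proof. by apply/funext => y; rewrite fct_sumE dotE. Qed.

Lemma differentiable_dot n (F G : V -> 'cV[R]_n) x : differentiable F x ->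
  differentiable G x -> differentiable (fun y => dot (F y) (G y)) x.
Proof.
move=> dF dG; rewrite dot_fctE.
apply: (differentiable_sum (f := fun i => (fun y => F y i 0) * (fun y => G y i 0))).
by move=> i; apply: differentiableM; exact: differentiable_coordinate.
Qed.

Lemma derive_dot n (F G : V -> 'cV[R]_n) x v :
  differentiable F x -> differentiable G x ->
  'D_v (fun y => dot (F y) (G y)) x =
  dot ('D_v F x) (G x) + dot (F x) ('D_v G x).
Proof.
move=> dF dG; rewrite dot_fctE derive_sum => [|i]; last first.
  by apply: derivableM; apply: diff_derivable; exact: differentiable_coordinate.
rewrite !dotE -big_split /=; apply: eq_bigr => i _.
rewrite deriveM; try by apply: diff_derivable; exact: differentiable_coordinate.
by rewrite !derive_coordinate// /GRing.scale /=; ring.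
Qed.

End ProductRule.

Section Stacked.
Context {R : realType} {n m : nat}.
Implicit Types (Psi : 'cV[R]_n -> 'cV[R]_m -> R).

Definition stack Psi (w : 'cV[R]_(n + m)) : R := Psi (usubmx w) (dsubmx w).

Lemma derive_stackl Psi z lam v :
  'D_(col_mx v 0) (stack Psi) (col_mx z lam) = 'D_v (Psi^~ lam) z.
Proof.
rewrite /derive; set f := (fun h => _); set g := (fun h => _).
suff -> : f = g by []; apply/funext => h; rewrite /f /g /stack /=.
by rewrite scale_col_mx add_col_mx !col_mxKu !col_mxKd scaler0 add0r.
Qed.

Lemma derive_stackr Psi z lam v :
  'D_(col_mx 0 v) (stack Psi) (col_mx z lam) = 'D_v (Psi z) lam.
Proof.
rewrite /derive; set f := (fun h => _); set g := (fun h => _).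
suff -> : f = g by []; apply/funext => h; rewrite /f /g /stack /=.
by rewrite scale_col_mx add_col_mx !col_mxKu !col_mxKd scaler0 add0r.
Qed.

Lemma delta_lshift (i : 'I_n) :
  delta_mx (lshift m i) 0 = col_mx (delta_mx i 0) 0 :> 'cV[R]_(n + m).
Proof.
apply/matrixP => k j; rewrite !mxE; case: splitP => l kl; rewrite !mxE.
  by rewrite -!val_eqE /= kl.
by rewrite -val_eqE /= kl gtn_eqF// ltn_addr.
Qed.

Lemma delta_rshift (i : 'I_m) :
  delta_mx (rshift n i) 0 = col_mx 0 (delta_mx i 0) :> 'cV[R]_(n + m).
Proof.
apply/matrixP => k j; rewrite !mxE; case: splitP => l kl; rewrite !mxE.
  by rewrite -val_eqE /= kl ltn_eqF// ltn_addr.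
by rewrite -!val_eqE /= kl eqn_add2l.
Qed.

Lemma grad2_stack Psi z lam : grad2 Psi z lam = grad (stack Psi) (col_mx z lam).
Proof.
apply/matrixP => k j; rewrite ord1 [LHS]mxE [RHS]mxE.
case: splitP => l kl; rewrite mxE.
  by rewrite (_ : k = lshift m l) ?delta_lshift ?derive_stackl//; exact: val_inj.
by rewrite (_ : k = rshift n l) ?delta_rshift ?derive_stackr//; exact: val_inj.
Qed.

Lemma usub_linear : linear (usubmx : 'cV[R]_(n + m) -> 'cV[R]_n).
Proof. by move=> a u v; rewrite linearP. Qed.

Lemma dsub_linear : linear (dsubmx : 'cV[R]_(n + m) -> 'cV[R]_m).
Proof. by move=> a u v; rewrite linearP. Qed.

Variables (obj : 'cV[R]_n -> R) (c : 'cV[R]_n -> 'cV[R]_m).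
Hypothesis c_obj : cont_diff 2 obj.
Hypothesis c_c : cont_diff 2 c.
Variable L : 'cV[R]_n -> 'cV[R]_m -> R.
Hypothesis LE : forall z lam, L z lam = obj z + dot lam (c z).

Let d_obj z : differentiable obj z. Proof. by have [] := c_obj. Qed.
Let d_c z : differentiable c z. Proof. by have [] := c_c. Qed.

Lemma cont_diff_stack : cont_diff 2 (stack L).
Proof.
have ul := usub_linear; have dl := dsub_linear.
have -> : stack L = fun w => obj (usubmx w) +
    \sum_(i < m) dsubmx w i 0 * c (usubmx w) i 0.
  by apply/funext => w; rewrite /stack LE dotE.
apply: cont_diffD.
  by apply: cont_diff_comp_lin => //; exact: linear_col_continuous.
apply: cont_diff_sum => i; apply: cont_diffM.
  apply: cont_diff_coord; apply: cont_diff_lin => //.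
  exact: linear_col_continuous.
apply: cont_diff_coord; apply: cont_diff_comp_lin => //.
exact: linear_col_continuous.
Qed.

Let dot_linear k (u : 'cV[R]_k) : linear (fun v : 'cV[R]_k => dot v u).
Proof. by move=> a v w; rewrite dotDl dotZl. Qed.

Let dot_linearr k (u : 'cV[R]_k) : linear (fun v : 'cV[R]_k => dot u v).
Proof. by move=> a v w; rewrite dotDr dotZr. Qed.

Let derive_affine k (a : R) (u x v : 'cV[R]_k) :
  'D_v (fun y : 'cV[R]_k => a + dot y u) x = dot v u.
Proof.
have ul := dot_linear u; have uc := linear_col_continuous ul.
have [du Du] := lin_diff x ul uc.
rewrite -[LHS]/('D_v (cst a + (fun y : 'cV[R]_k => dot y u)) x) deriveD.
- by rewrite derive_cst add0r Du.
- exact: derivable_cst.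
- exact: diff_derivable.
Qed.

Lemma derive_Lz z lam v :
  'D_v (L^~ lam) z = 'D_v obj z + dot lam ('D_v c z).
Proof.
have -> : L^~ lam = obj + (fun y => dot lam (c y)).
  by apply/funext => y; rewrite LE.
have ul := dot_linearr lam; have uc := linear_col_continuous ul.
have [du _] := lin_diff (c z) ul uc.
rewrite deriveD.
- by rewrite (derive_lin_comp _ ul uc).
- exact: diff_derivable.
- by apply: diff_derivable; exact: (differentiable_comp (d_c z) du).
Qed.

Lemma derive_Llam z lam v : 'D_v (L z) lam = dot v (c z).
Proof.
have -> : L z = fun y => obj z + dot y (c z) by apply/funext => y; rewrite LE.
exact: derive_affine.
Qed.

(** The multipliers enter linearly, so the mixed second derivatives are first
    derivatives of the constraints. *)
Lemma hess_stack z lam : hess (stack L) (col_mx z lam) =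
  block_mx (hess (L^~ lam) z) (jac c z)^T (jac c z) 0.
Proof.
have dg w : differentiable (grad (stack L)) w.
  by have [] := cont_diff_grad cont_diff_stack.
have dgz z' : differentiable (grad (L^~ lam)) z'.
  suff : cont_diff 1 (grad (L^~ lam)) by case.
  apply: cont_diff_grad.
  have -> : L^~ lam = fun y => obj y + dot lam (c y).
    by apply/funext => y; rewrite LE.
  have ll := dot_linearr lam; have lc := linear_col_continuous ll.
  exact: (cont_diffD c_obj (cont_diff_lin_comp ll lc c_c)).
have coordL i : (fun w => grad (stack L) w (lshift m i) 0) =
    stack (fun z lam => 'D_(delta_mx i 0) (L^~ lam) z).
  apply/funext => w; rewrite mxE delta_lshift -{1}[w]vsubmxK.
  exact: derive_stackl.
have coordR i : (fun w => grad (stack L) w (rshift n i) 0) =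
    stack (fun z lam => 'D_(delta_mx i 0) (L z) lam).
  apply/funext => w; rewrite mxE delta_rshift -{1}[w]vsubmxK.
  exact: derive_stackr.
apply/matrixP => k j; rewrite [LHS]mxE -derive_coordinate//.
rewrite [RHS]mxE; case: splitP => k' kE; rewrite mxE; case: splitP => j' jE.
- have -> : k = lshift m k' by exact: val_inj.
  have -> : j = lshift m j' by exact: val_inj.
  rewrite coordL delta_lshift derive_stackl [RHS]mxE -derive_coordinate//.
  by congr ('D__ _ _); apply/funext => y; rewrite mxE.
- have -> : k = lshift m k' by exact: val_inj.
  have -> : j = rshift n j' by exact: val_inj.
  rewrite coordL delta_rshift derive_stackr 2!mxE.
  have -> : (fun lam' => 'D_(delta_mx k' 0) (L^~ lam') z) =
     fun lam' => 'D_(delta_mx k' 0) obj z + dot lam' ('D_(delta_mx k' 0) c z).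
    by apply/funext => y; rewrite derive_Lz.
  by rewrite derive_affine dot_delta.
- have -> : k = rshift n k' by exact: val_inj.
  have -> : j = lshift m j' by exact: val_inj.
  rewrite coordR delta_lshift derive_stackl mxE -derive_coordinate//.
  congr ('D__ _ _); apply/funext => y.
  by rewrite derive_Llam dot_delta.
- have -> : k = rshift n k' by exact: val_inj.
  have -> : j = rshift n j' by exact: val_inj.
  rewrite coordR delta_rshift derive_stackr mxE.
  have -> : (fun lam' => 'D_(delta_mx k' 0) (L z) lam') =
     fun _ => c z k' 0.
    by apply/funext => y; rewrite derive_Llam dot_delta.
  by rewrite derive_cst.
Qed.

Variables eta1 eta2 : R.

Definition stack_merit (w : 'cV[R]_(n + m)) : R :=
  stack L w + wdot eta1 eta2 (grad (stack L) w) (grad (stack L) w) / 2.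

Let gradu w := usubmx (grad (stack L) w).
Let gradd w := dsubmx (grad (stack L) w).

Let d_gradS w : differentiable (grad (stack L)) w.
Proof. by have [] := cont_diff_grad cont_diff_stack. Qed.

Let uc : continuous (usubmx : 'cV[R]_(n + m) -> 'cV[R]_n).
Proof. exact: (linear_col_continuous usub_linear). Qed.

Let dc : continuous (dsubmx : 'cV[R]_(n + m) -> 'cV[R]_m).
Proof. exact: (linear_col_continuous dsub_linear). Qed.

Let d_gradu w : differentiable gradu w.
Proof.
apply: differentiable_comp => //.
by have [] := lin_diff (grad (stack L) w) usub_linear uc.
Qed.

Let d_gradd w : differentiable gradd w.
Proof.
apply: differentiable_comp => //.
by have [] := lin_diff (grad (stack L) w) dsub_linear dc.
Qed.

Let stack_meritE : stack_merit =
  stack L + ((eta2 / 2) *: (fun w => dot (gradu w) (gradu w)) +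
             (eta1 / 2) *: (fun w => dot (gradd w) (gradd w))).
Proof.
apply/funext => y; rewrite /stack_merit /wdot -/(gradu y) -/(gradd y).
rewrite -[RHS]/(stack L y + (eta2 / 2 * dot (gradu y) (gradu y)
                             + eta1 / 2 * dot (gradd y) (gradd y))).
by ring.
Qed.

Let d_stack w : differentiable (stack L) w.
Proof. by have [] := cont_diff_stack. Qed.

Lemma differentiable_stack_merit w : differentiable stack_merit w.
Proof.
have duu := differentiable_dot (d_gradu w) (d_gradu w).
have ddd := differentiable_dot (d_gradd w) (d_gradd w).
rewrite stack_meritE; apply: (differentiableD (d_stack w)).
exact: (differentiableD (differentiableZ _ duu) (differentiableZ _ ddd)).
Qed.

Lemma derive_stack_merit w v : 'D_v stack_merit w =
  dot (grad (stack L) w) v +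
  wdot eta1 eta2 (grad (stack L) w) (hess (stack L) w *m v).
Proof.
have Du : 'D_v gradu w = usubmx (hess (stack L) w *m v).
  by rewrite (derive_lin_comp _ usub_linear uc)// -jac_mul.
have Dd : 'D_v gradd w = dsubmx (hess (stack L) w *m v).
  by rewrite (derive_lin_comp _ dsub_linear dc)// -jac_mul.
have duu := diff_derivable (v := v) (differentiable_dot (d_gradu w) (d_gradu w)).
have ddd := diff_derivable (v := v) (differentiable_dot (d_gradd w) (d_gradd w)).
have duZ := derivableZ (k := eta2 / 2) duu.
have ddZ := derivableZ (k := eta1 / 2) ddd.
rewrite stack_meritE (deriveD (diff_derivable (d_stack w)) (derivableD duZ ddZ)).
rewrite (deriveD duZ ddZ) !deriveZ// !derive_dot// Du Dd derive_dot_grad// /wdot.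
rewrite -/(gradu w) -/(gradd w).
rewrite (dotC _ (gradu w)) (dotC _ (gradd w)) /GRing.scale /=.
by field.
Qed.

End Stacked.

(** * Block structure of the constraint Jacobian and of the modified Hessian *)

Section Blocks.
Context {R : realType} {nx nu N : nat}.
Local Notation nz := (dimz nx nu N).
Local Notation nl := (diml nx N).
Variable P : nldp R nx nu N.

Lemma zblk_linear k : linear (fun z : 'cV[R]_nz => zblk z k).
Proof.
by move=> a u v; apply/matrixP => i j; rewrite /zblk !mxE.
Qed.

Lemma zlast_linear : linear (@zlast R nx nu N).
Proof. by move=> a u v; rewrite /zlast linearP. Qed.

Lemma xblk_linear k : linear (fun z : 'cV[R]_nz => xblk z k).
Proof.
move=> a u v; rewrite /xblk; case: unlift => [j|]; last exact: zlast_linear.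
by rewrite zblk_linear linearP.
Qed.

Lemma xblk_max (z : 'cV[R]_nz) : xblk z ord_max = zlast z.
Proof. by rewrite /xblk unlift_none. Qed.

Lemma xblk_lift (z : 'cV[R]_nz) k : xblk z (lift ord_max k) = usubmx (zblk z k).
Proof. by rewrite /xblk liftK. Qed.

Lemma lblk0 (q : 'cV[R]_nl) : lblk q ord0 = usubmx q.
Proof. by rewrite /lblk unlift_none. Qed.

Lemma lblkS (q : 'cV[R]_nl) k : lblk q (lift ord0 k) = submxcol (dsubmx q) k.
Proof. by rewrite /lblk liftK. Qed.

Lemma lblkK (q : 'cV[R]_nl) :
  q = col_mx (lblk q ord0) (\mxcol_(k < N) lblk q (lift ord0 k)).
Proof.
rewrite lblk0 -{1}[q]vsubmxK; congr col_mx.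
by rewrite -{1}[dsubmx q]submxcolK; apply/eq_mxcol => k; rewrite lblkS.
Qed.

Lemma zblkK (z : 'cV[R]_nz) : z = col_mx (\mxcol_(k < N) zblk z k) (zlast z).
Proof. by rewrite -{1}[z]vsubmxK -{1}[usubmx z]submxcolK. Qed.

Lemma lblk_linear k : linear (fun q : 'cV[R]_nl => lblk q k).
Proof.
move=> a u v; rewrite /lblk; case: unlift => [j|]; last by rewrite linearP.
by apply/matrixP => i l; rewrite !mxE.
Qed.

Hypothesis c_cost : forall k, cont_diff 3 (stage_cost P k).
Hypothesis c_final : cont_diff 3 (final_cost P).
Hypothesis c_dyn : forall k, cont_diff 3 (dynamics P k).

Lemma cont_diff_objective : cont_diff 3 (@objective R nx nu N P).
Proof.
apply: cont_diffD; last first.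
  have zc := linear_col_continuous zlast_linear.
  exact: (cont_diff_comp_lin zlast_linear zc c_final).
apply: cont_diff_sum => k.
exact: (cont_diff_comp_lin (zblk_linear k) (linear_col_continuous (zblk_linear k))).
Qed.

Let cont_diff_xblk k : cont_diff 3 (fun z : 'cV[R]_nz => xblk z k).
Proof.
exact: (cont_diff_lin _ (xblk_linear k) (linear_col_continuous (xblk_linear k))).
Qed.

Let cont_diff_step k : cont_diff 3
  (fun z : 'cV[R]_nz => xblk z (lift ord0 k) - dynamics P k (zblk z k)).
Proof.
apply: cont_diffD => //; apply: cont_diffN.
exact: (cont_diff_comp_lin (zblk_linear k) (linear_col_continuous (zblk_linear k))).
Qed.

Lemma cont_diff_constr : cont_diff 3 (@constr R nx nu N P).
Proof.
apply: cont_diff_col => i.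
have [[l iE]|[l iE]] : (exists l, i = lshift _ l) \/ (exists l, i = rshift nx l).
  by case: (splitP i) => l il; [left|right]; exists l; exact: val_inj.
- have -> : (fun z : 'cV[R]_nz => constr P z i 0) =
      (fun z => (xblk z ord0 - x0bar P) l 0).
    by apply/funext => z; rewrite iE /constr col_mxEu.
  by apply: cont_diff_coord; apply: cont_diffD => //; exact: cont_diff_cst.
- set k := tagnat.sig1 l.
  have -> : (fun z : 'cV[R]_nz => constr P z i 0) =
      (fun z => (xblk z (lift ord0 k) - dynamics P k (zblk z k)) (tagnat.sig2 l) 0).
    by apply/funext => z; rewrite iE /constr col_mxEd mxE.
  exact: cont_diff_coord.
Qed.

Let d_constr z : differentiable (@constr R nx nu N P) z.
Proof. by have [] := cont_diff_constr. Qed.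

Let d_dyn k y : differentiable (dynamics P k) y.
Proof. by have [] := c_dyn k. Qed.

Let lblk_constr0 z : lblk (constr P z) ord0 = xblk z ord0 - x0bar P.
Proof. by rewrite lblk0 /constr col_mxKu. Qed.

Let lblk_constrS z k :
  lblk (constr P z) (lift ord0 k) = xblk z (lift ord0 k) - dynamics P k (zblk z k).
Proof. by rewrite lblkS /constr col_mxKd mxcolK. Qed.

Let derive_lblk z p k :
  lblk (Gmx P z *m p) k = 'D_p (fun y => lblk (constr P y) k) z.
Proof.
have ll := lblk_linear k; have lc := linear_col_continuous ll.
by rewrite (derive_lin_comp _ ll lc)// /Gmx jac_mul.
Qed.

Lemma lblk_Gmx0 z p : lblk (Gmx P z *m p) ord0 = xblk p ord0.
Proof.
rewrite derive_lblk.
have -> : (fun y => lblk (constr P y) ord0) = (fun y => xblk y ord0) - cst (x0bar P).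
  by apply/funext => y; rewrite lblk_constr0.
have xl := xblk_linear ord0; have xc := linear_col_continuous xl.
have [dx Dx] := lin_diff z xl xc.
rewrite deriveB ?derive_cst ?subr0 ?Dx//; exact: diff_derivable.
Qed.

Lemma lblk_GmxS z p k : lblk (Gmx P z *m p) (lift ord0 k) =
  xblk p (lift ord0 k) - (Amx P k (zblk z k) *m usubmx (zblk p k)
                          + Bmx P k (zblk z k) *m dsubmx (zblk p k)).
Proof.
rewrite derive_lblk.
have -> : (fun y => lblk (constr P y) (lift ord0 k)) =
    (fun y => xblk y (lift ord0 k)) - (fun y => dynamics P k (zblk y k)).
  by apply/funext => y; rewrite lblk_constrS.
have xl := xblk_linear (lift ord0 k); have xc := linear_col_continuous xl.
have [dx Dx] := lin_diff z xl xc.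
have zl := zblk_linear k; have zc := linear_col_continuous zl.
have [dz Dz] := lin_diff z zl zc.
rewrite deriveB; first last.
- by apply: diff_derivable; exact: (differentiable_comp dz (d_dyn k (zblk z k))).
- exact: diff_derivable.
rewrite Dx (derive_comp_lin _ _ _ zl) -jac_mul//; congr (_ - _).
by rewrite /Amx /Bmx -mul_row_col hsubmxK vsubmxK.
Qed.

Lemma ext0E m n (F : 'I_N -> 'M[R]_(m, n)) (k : 'I_N) : ext0 F k = F k.
Proof. by rewrite /ext0 valK. Qed.

Section Adjoint.
Variables (z : 'cV[R]_nz) (q : 'cV[R]_nl).

Let A := ext0 (fun i => Amx P i (zblk z i)).
Let B := ext0 (fun i => Bmx P i (zblk z i)).

Definition lseq (j : nat) : 'cV[R]_nx := lblk q (inord j).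

Lemma lseqE (k : 'I_N.+1) : lblk q k = lseq k.
Proof. by rewrite /lseq inord_val. Qed.

Lemma Gmx_tr : (Gmx P z)^T *m q =
  col_mx (\mxcol_(k < N) col_mx (rx A lseq k) (- ru B lseq k)) (lseq N).
Proof.
set r := RHS.
suff h p : dot ((Gmx P z)^T *m q) p = dot r p.
  by apply/matrixP => i j; rewrite ord1 -!dot_delta ![dot (delta_mx _ _) _]dotC h.
pose x k := dot (lblk q k) (xblk p k).
pose y (k : 'I_N) := dot (lblk q (lift ord0 k))
  (Amx P k (zblk z k) *m usubmx (zblk p k)
   + Bmx P k (zblk z k) *m dsubmx (zblk p k)).
have -> : dot ((Gmx P z)^T *m q) p = \sum_(k < N.+1) x k - \sum_(k < N) y k.
  rewrite -dot_mul {1}[q]lblkK [Gmx P z *m p]lblkK dot_col dot_mxcol lblk_Gmx0.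
  rewrite (big_ord_recl N) -addrA -sumrB; congr (_ + _).
  by apply: eq_bigr => k _; rewrite lblk_GmxS dotBr.
rewrite (big_ord_recr N) /= addrAC -sumrB /r [p in RHS]zblkK dot_col dot_mxcol.
congr (_ + _); last by rewrite /x xblk_max lseqE.
apply: eq_bigr => k _; rewrite /x /y.
have -> : widen_ord (leqnSn N) k = lift ord_max k.
  by apply: val_inj; exact/esym/lift_max.
rewrite xblk_lift -{4}[zblk p k]vsubmxK dot_col !lseqE lift_max.
rewrite /rx /ru /A /B !ext0E dotBl dotNl dotDr !dot_mul.
by rewrite lift0 opprD addrA.
Qed.

Lemma sqr_enorm_Gmx_tr : enorm ((Gmx P z)^T *m q) ^+ 2 =
  \sum_(0 <= k < N) rho A B lseq k + enorm (lseq N) ^+ 2.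
Proof.
rewrite Gmx_tr sqr_enorm_col sqr_enorm_mxcol big_mkord; congr (_ + _).
by apply: eq_bigr => k _; rewrite sqr_enorm_col enormN.
Qed.

Lemma sqr_enorm_lseq : enorm q ^+ 2 =
  \sum_(0 <= k < N) enorm (lseq k) ^+ 2 + enorm (lseq N) ^+ 2.
Proof.
rewrite {1}[q]lblkK sqr_enorm_col sqr_enorm_mxcol.
rewrite -(big_ord_recl _ (fun k => enorm (lblk q k) ^+ 2)).
rewrite -(big_nat_recr N 0 (fun k => enorm (lseq k) ^+ 2))//= big_mkord.
by apply: eq_bigr => k _; rewrite lseqE.
Qed.

End Adjoint.

(** Uniform full row rank of [Gmx], with the explicit constant: [Gmx^T *m q] is
    the residual of the adjoint recursion for the blocks of [q]. *)
Lemma Gmx_tr_ge z U gC t : (0 < nx)%N -> 1 < U -> 0 < gC ->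
  (forall k, opnorm (Amx P k (zblk z k)) <= U /\ opnorm (Bmx P k (zblk z k)) <= U) ->
  (forall k : nat, (k + t <= N)%N -> exists2 tk : nat, (1 <= tk <= t)%N &
      loewner_ge (Xi P z k tk *m (Xi P z k tk)^T) gC) ->
  forall q : 'cV[R]_nl, 4 / 9 * gamma_G gC U t * enorm q ^+ 2 <=
    enorm ((Gmx P z)^T *m q) ^+ 2.
Proof.
move=> hnx U1 gC0 AB hC q.
have U0 : 0 <= U by rewrite ltW// (lt_trans ltr01).
have ext_le m n (F : 'I_N -> 'M[R]_(m, n)) : (forall k, opnorm (F k) <= U) ->
    forall k (v : 'cV[R]_m), enorm ((ext0 F k)^T *m v) <= U * enorm v.
  move=> FU k; apply: mul_tr_le => // v.
  rewrite /ext0; case: insubP => [i _ _|_] /=; first exact: opnorm_leP.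
  by rewrite mul0mx enorm0 mulr_ge0 ?enorm_ge0.
have hA := ext_le _ _ _ (fun k => (AB k).1).
have hB := ext_le _ _ _ (fun k => (AB k).2).
have := adjoint_le hnx U1 hA hB (lseq q) gC0 (N := N) (t := t).
rewrite -sqr_enorm_lseq -sqr_enorm_Gmx_tr sqr_adjoint_const//.
have g0 := gamma_G_gt0 t U1 gC0.
move=> h; have {}h : enorm q ^+ 2 <=
    9 / 4 / gamma_G gC U t * enorm ((Gmx P z)^T *m q) ^+ 2.
  apply: h => k kt; have [tk tk1 hk] := hC k kt; exists tk => // v.
  by have := hk v; rewrite -mulmxA dot_mul -sqr_enorm.
have g1 : 0 < 4 / 9 * gamma_G gC U t by rewrite mulr_gt0// divr_gt0.
move: h; rewrite -(ler_pM2l g1) mulrA => h; apply: le_trans h _.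
rewrite mulrA le_eqVlt; apply/orP; left; apply/eqP.
rewrite -[RHS]mul1r; congr (_ * _).
by field; rewrite gt_eqF.
Qed.

Variable S : iterates R nx nu N.

Lemma Hhat_le tau U (v : 'cV[R]_nz) :
  (forall k, opnorm (sHhat S tau k) <= U) -> opnorm (sHhatN S tau) <= U -> 0 <= U ->
  enorm (Hhat S tau *m v) <= U * enorm v.
Proof.
move=> hk hN U0; rewrite [v]zblkK /Hhat mul_block_col !mul0mx addr0 add0r.
rewrite mul_mxdiag_mxcol -ler_sqr ?nnegrE ?mulr_ge0 ?enorm_ge0//.
rewrite exprMn !sqr_enorm_col !sqr_enorm_mxcol mulrDr mulr_sumr; apply: lerD.
  apply: ler_sum => k _.
  by rewrite -exprMn ler_sqr ?nnegrE ?mulr_ge0 ?enorm_ge0// opnorm_leP.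
by rewrite -exprMn ler_sqr ?nnegrE ?mulr_ge0 ?enorm_ge0// opnorm_leP.
Qed.

Lemma Hhat_sym tau : (forall k, (sHhat S tau k)^T = sHhat S tau k) ->
  (sHhatN S tau)^T = sHhatN S tau -> (Hhat S tau)^T = Hhat S tau.
Proof.
move=> hk hN; rewrite /Hhat tr_block_mx !trmx0 hN; congr block_mx.
by rewrite tr_mxdiag; apply: eq_mxdiag.
Qed.

End Blocks.

(** * Acceptance of the unit step *)

Section Auxiliary.
Context {R : realType}.

Lemma reduced_form_ge n m (H : 'M[R]_n) (G : 'M[R]_(m, n)) g :
  (forall q (Z : 'M[R]_(n, q)), Z^T *m Z = 1%:M ->
    (forall w : 'cV[R]_n, G *m w = 0 <-> exists y : 'cV[R]_q, w = Z *m y) ->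
    loewner_ge (Z^T *m H *m Z) g) ->
  forall p, G *m p = 0 -> g * enorm p ^+ 2 <= dot p (H *m p).
Proof.
move=> hZ p Gp; have [r [Z [ZZ GZ]]] := orthonormal_kernel G.
have [y pE] := (GZ p).1 Gp; have := hZ _ _ ZZ GZ y.
have -> : Z^T *m H *m Z *m y = Z^T *m (H *m (Z *m y)) by rewrite !mulmxA.
rewrite dot_mul trmxK -pE; congr (g * _ <= _).
by rewrite pE !sqr_enorm [RHS]dot_mul mulmxA ZZ mul1mx.
Qed.

Lemma diml_lt_dimz nx nu N : (0 < nu)%N -> (0 < N)%N ->
  (diml nx N < dimz nx nu N)%N.
Proof.
move=> nu0 N0; rewrite !sum_nat_const card_ord mulnDr addnC ltn_add2r.
by rewrite -{1}[(N * nx)%N]addn0 ltn_add2l muln_gt0 N0.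
Qed.

(** The form [bil] is at most linear in [K *m Delta], so its lower bound gives a
    bound for the inverse of [K]. *)
Lemma newton_le n m eta1 eta2 (K : 'M[R]_(n + m)) Delta c kappa :
  0 < eta1 -> 0 < eta2 -> 0 < c -> 0 <= kappa ->
  (forall v, enorm (K *m v) <= kappa * enorm v) ->
  c * enorm Delta ^+ 2 <= bil eta1 eta2 K Delta Delta ->
  enorm Delta <= (1 + (eta1 + eta2) * kappa) / c * enorm (K *m Delta).
Proof.
move=> e1 e2 c0 k0 hK hc; have h0 : 0 < eta1 + eta2 by rewrite addr_gt0.
have [->|D0] := eqVneq Delta 0.
  by rewrite enorm0 !mulr_ge0 ?invr_ge0 ?enorm_ge0 ?addr_ge0 ?mulr_ge0// ltW.
have Dp := enorm_gt0 D0.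
rewrite mulrAC ler_pdivlMr// -(ler_pM2r Dp).
have a1 := dot_ler Delta (K *m Delta).
have a2 := le_trans (ler_norm _) (wdot_le e1 e2 (K *m Delta) (K *m Delta)).
have a3 := ler_wpM2l (ltW h0) (ler_wpM2r (enorm_ge0 (K *m Delta)) (hK Delta)).
by move: hc; rewrite /bil expr2; lra.
Qed.

(** The arithmetic of the constants: [eta1] dominates every other term in the
    bound on [bil], up to one tenth. *)
Lemma step_margin (Y gRH gG eta1 eta2 beta delta : R) :
  1 <= Y -> 0 < gRH -> gRH <= Y -> 0 < gG -> gG <= 1 -> 0 < eta1 -> 0 < eta2 ->
  0 < beta < 1 / 2 -> 0 < delta ->
  17 <= eta1 * (eta2 * gG) -> eta2 * (12 * Y ^+ 2) <= gRH ->
  delta <= (1 / 2 - beta) / (3 / 2 - beta) * (eta2 * gG / (9 * eta1 * Y ^+ 2)) ->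
  (beta + delta / 2) * delta * (3 * Y + 4 * eta2 * Y ^+ 2 + eta1 * Y ^+ 2)
    < (1 / 2 - beta) * (eta2 * (4 / 9 * gG) / 4).
Proof.
move=> Y1 r0 rY g0 g1 e10 e20 /andP[b0 b2] d0 e1g e2Y hd.
have Y0 : 0 < Y := lt_le_trans ltr01 Y1.
have Y2 : 1 <= Y ^+ 2 by rewrite exprn_ege1.
have YY : Y <= Y ^+ 2 by rewrite expr2 ler_peMr// ltW.
have Y2p : 0 < Y ^+ 2 := lt_le_trans ltr01 Y2.
have p0 : 0 < eta2 * gG by rewrite mulr_gt0.
have eg : eta2 * gG <= eta2 by rewrite ler_piMr// ltW.
have e17 : 17 <= eta1 * eta2 by apply: le_trans e1g _; rewrite ler_pM2l.
have e1Y : 204 * Y <= eta1.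
  rewrite -(ler_pM2r Y0).
  have a : 12 * (eta1 * eta2) * Y ^+ 2 <= eta1 * Y.
    have : eta1 * (eta2 * (12 * Y ^+ 2)) <= eta1 * Y.
      by rewrite ler_pM2l// (le_trans e2Y).
    by lra.
  have b : 17 * Y ^+ 2 <= eta1 * eta2 * Y ^+ 2 by rewrite ler_pM2r.
  by move: a b; rewrite expr2; lra.
have e1YY : 204 * Y <= eta1 * Y ^+ 2.
  by apply: le_trans e1Y _; rewrite ler_peMr// ltW.
have e2Y12 : 12 * (eta2 * Y ^+ 2) <= Y by apply: le_trans rY; move: e2Y; lra.
set b := 3 * Y + _ + _.
have bp : b <= 11 / 10 * (eta1 * Y ^+ 2) by rewrite /b; move: e1YY e2Y12 Y0; lra.
have X0 : 0 < eta1 * Y ^+ 2 by rewrite mulr_gt0.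
have beta32 : 0 < 3 / 2 - beta by lra.
have dX : delta * (eta1 * Y ^+ 2) * (3 / 2 - beta) <=
    (1 / 2 - beta) * (eta2 * gG / 9).
  have := hd; rewrite -(ler_pM2r X0) -(ler_pM2r beta32).
  have -> : (1 / 2 - beta) / (3 / 2 - beta) * (eta2 * gG / (9 * eta1 * Y ^+ 2)) *
     (eta1 * Y ^+ 2) * (3 / 2 - beta) = (1 / 2 - beta) * (eta2 * gG / 9).
    have cancel a B p X : B != 0 -> X != 0 ->
        a / B * (p / (9 * X)) * X * B = a * (p / 9) :> R.
      by move=> B0 X0'; field; rewrite ?B0 ?X0'.
    by rewrite -(mulrA 9) cancel ?gt_eqF.
  by [].
have b12 : 0 < 1 / 2 - beta by lra.
have dsmall : delta <= 1 / 2 - beta.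
  have a : delta * 1 <= delta * (eta1 * Y ^+ 2 * (3 / 2 - beta)).
    rewrite ler_pM2l//.
    have : 1 * 1 <= eta1 * Y ^+ 2 * (3 / 2 - beta).
      by apply: ler_pM => //; [move: e1YY Y1; lra|lra].
    by rewrite mul1r.
  have e : eta2 * gG / 9 <= 1.
    have : 12 * eta2 <= 12 * (eta2 * Y ^+ 2) by rewrite ler_pM2l// ler_peMr// ltW.
    have : 12 * (eta2 * Y ^+ 2) * Y <= Y * Y by rewrite ler_pM2r.
    have k : eta2 * Y <= eta2 * Y ^+ 2 by rewrite ler_pM2l.
    have l : 12 * (eta2 * Y) <= Y by move: k e2Y12; lra.
    have m : 12 * eta2 <= 1 by rewrite -(ler_pM2r Y0) mul1r; move: l; lra.
    by move: eg m; lra.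
  have f : (1 / 2 - beta) * (eta2 * gG / 9) <= (1 / 2 - beta) * 1.
    by rewrite ler_pM2l.
  by move: a dX f; lra.
set p := eta2 * gG in p0 dX *.
have bd0 : 0 < beta + delta / 2 by rewrite addr_gt0// divr_gt0.
have s1 : (beta + delta / 2) * (delta * b) <=
    (beta + delta / 2) * (delta * (11 / 10 * (eta1 * Y ^+ 2))).
  by rewrite ler_pM2l// ler_pM2l.
have s2 : 11 / 10 * (beta + delta / 2) < 3 / 2 - beta by lra.
have s3 : 11 / 10 * (beta + delta / 2) * (delta * (eta1 * Y ^+ 2)) <
    (3 / 2 - beta) * (delta * (eta1 * Y ^+ 2)).
  by rewrite ltr_pM2r// mulr_gt0.
have -> : eta2 * (4 / 9 * gG) / 4 = p / 9 by rewrite /p; field.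
by move: s1 s3 dX; lra.
Qed.

End Auxiliary.

Section Merit.
Context {R : realType} {nx nu N : nat}.
Variables (P : nldp R nx nu N) (eta1 eta2 : R).
Let L := @lagrangian R nx nu N P.

Lemma meritE z lam :
  merit P eta1 eta2 z lam = stack_merit L eta1 eta2 (col_mx z lam).
Proof.
rewrite /merit /stack_merit -grad2_stack /grad2 /wdot /stack !col_mxKu !col_mxKd.
by rewrite -!sqr_enorm /L; field.
Qed.

Lemma stack_merit_eq : stack (merit P eta1 eta2) = stack_merit L eta1 eta2.
Proof. by apply/funext => w; rewrite /stack meritE vsubmxK. Qed.

End Merit.

Theorem theorem6p1 (R : realType) (nx nu N : nat)
    (hnx : (0 < nx)%N) (hnu : (0 < nu)%N) (hN : (0 < N)%N)
    (P : nldp R nx nu N) (S : iterates R nx nu N) (X : boxes R nx nu N)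
    (zs : 'cV[R]_(dimz nx nu N)) (ls : 'cV[R]_(diml nx N))
    (eta1 eta2 beta r delta : R) (t : nat)
    (gRH gC Uupper UHG UKKT : R)
    (heta1 : 0 < eta1) (heta2 : 0 < eta2)
    (hbeta : 0 < beta < 1 / 2) (hr : 0 < r < 1) (hdelta : 0 < delta < 1)
    (hrun : sqp_run P S eta1 eta2 beta r)
    (hdir : inexact_direction S delta)
    (hz : sz S tau @[tau --> \oo] --> zs)
    (hl : slam S tau @[tau --> \oo] --> ls)
    (hKKT : gradL P zs ls = 0)
    (hRH : reduced_hessian P S gRH)
    (hC : controllability P S gC t)
    (hU1 : 1 < Uupper)
    (hU : upper_bounded P S Uupper)
    (hcpt : compactness P S X Uupper)
    (hvan : vanishing_modification P S)
    (hlip : local_lipschitz P zs ls)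
    (hUHG0 : 0 < UHG) (hUHG : HG_bound P X UHG)
    (hUKKT0 : 0 < UKKT) (hUKKT : KKT_bound P S UKKT) :
  let U := Num.max Uupper (Num.max UKKT UHG) in
  let gG := gamma_G gC Uupper t in
  17 / (eta2 * gG) <= eta1 ->
  eta2 <= gRH / (12 * U ^+ 2) ->
  delta <= (1 / 2 - beta) / (3 / 2 - beta)
           * (eta2 * gG / (9 * eta1 * U ^+ 2)) ->
  \forall tau \near \oo, salpha S tau = 1.
Proof.
move=> Y gG h1 h2 h3.
have [gC0 t0 hwin] := hC; have [gRH0 hZ] := hRH.
have [_ hiter [c_cost c_final c_dyn] _ _ _] := hcpt.
have [d0 d1] := andP hdelta.
have UY : Uupper <= Y by rewrite le_max lexx.
have HGY : UHG <= Y by rewrite !le_max lexx !orbT.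
have Y1 : 1 <= Y by rewrite ltW// (lt_le_trans hU1).
have Y0 : 0 < Y := lt_le_trans ltr01 Y1.
have g0 : 0 < gG := gamma_G_gt0 t hU1 gC0.
have g1 : gG <= 1 := gamma_G_le1 t hU1 gC0.
have eg0 : 0 < eta2 * gG by rewrite mulr_gt0.
have e1g : 17 <= eta1 * (eta2 * gG) by move: h1; rewrite ler_pdivrMr.
have e2Y : eta2 * (12 * Y ^+ 2) <= gRH.
  by move: h2; rewrite ler_pdivlMr// mulr_gt0// exprn_gt0.
pose G tau := Gmx P (sz S tau); pose H tau := Hhat S tau.
pose K tau := KKTmx P S tau.
pose w tau := col_mx (sz S tau) (slam S tau).
pose D tau := col_mx (sdz S tau) (sdlam S tau).
pose d tau := col_mx (sdzt S tau) (sdlamt S tau).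
pose ws := col_mx zs ls.
have inX tau : Zset X (sz S tau) /\ Lset X (slam S tau).
  by have := hiter tau 0; rewrite lexx ler01 !scale0r !addr0; apply.
have Gle tau p : enorm (G tau *m p) <= Y * enorm p.
  by apply: opnorm_leP; apply: le_trans HGY; apply: hUHG.2; case: (inX tau).
have Hle tau p : enorm (H tau *m p) <= Y * enorm p.
  have [hk hN'] := hU tau; apply: Hhat_le => [k||].
  - by have [hH _ _] := hk k; exact: le_trans UY.
  - exact: le_trans UY.
  - exact: ltW.
have GTge tau q : 4 / 9 * gG * enorm q ^+ 2 <= enorm ((G tau)^T *m q) ^+ 2.
  apply: (Gmx_tr_ge c_dyn) => //; last exact: hwin.
  move=> k.
  by have [hk _] := hU tau; have [_ hA hB] := hk k.
have redH tau p : G tau *m p = 0 -> gRH * enorm p ^+ 2 <= dot p (H tau *m p).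
  exact: (reduced_form_ge (hZ tau)).
have RHY : gRH <= Y.
  have [p p0 Gp] := kernel_exists (G 0) (diml_lt_dimz nx hnu hN).
  have pp : 0 < enorm p ^+ 2 by rewrite exprn_gt0// enorm_gt0.
  rewrite -(ler_pM2r pp); apply: le_trans (redH 0 p Gp) _.
  apply: le_trans (dot_ler _ _) _.
  by rewrite expr2 mulrCA ler_wpM2l ?enorm_ge0.
pose s := 4 / 9 * gG; have s0 : 0 < s by rewrite mulr_gt0// divr_gt0.
have s1 : s <= 1 by rewrite /s; move: g1 g0; lra.
have e12 : 15 / 2 <= eta1 * (eta2 * s) by rewrite /s; move: e1g; lra.
pose c := eta2 * s / 4; have c0 : 0 < c by rewrite divr_gt0// mulr_gt0.
have bil_ge tau : c * enorm (D tau) ^+ 2 <= bil eta1 eta2 (K tau) (D tau) (D tau).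
  exact: (bil_saddle_ge heta2 (Hle tau) Y1 gRH0 RHY s0 s1 (redH tau) (GTge tau)).
pose b := 3 * Y + 4 * eta2 * Y ^+ 2 + eta1 * Y ^+ 2.
have b0 : 0 <= b by rewrite !addr_ge0 ?mulr_ge0 ?exprn_ge0 ?ltW.
have bil_le tau u v : `|bil eta1 eta2 (K tau) u v| <= b * (enorm u * enorm v).
  exact: (bil_saddle_le heta1 heta2 (Hle tau) (Gle tau) Y1).
have Kle tau v : enorm (K tau *m v) <= 3 * Y * enorm v.
  exact: (saddle_le (Hle tau) (Gle tau) Y1).
have Ksym tau : (K tau)^T = K tau.
  have [hk hN'] := sqp_sym hrun tau.
  by rewrite /K /KKTmx tr_block_mx trmx0 trmxK Hhat_sym.
have gap := step_margin Y1 gRH0 RHY g0 g1 heta1 heta2 hbeta d0 e1g e2Y h3.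
rewrite -/s -/c -/b in gap.
pose L := @lagrangian R nx nu N P; pose Phi := stack L.
have LE z lam : L z lam = objective P z + dot lam (constr P z) by [].
have cobj : cont_diff 2 (@objective R nx nu N P).
  by apply: cont_diffS; exact: cont_diff_objective.
have ccon : cont_diff 2 (@constr R nx nu N P).
  by apply: cont_diffS; exact: cont_diff_constr.
have cPhi : cont_diff 2 Phi := cont_diff_stack cobj ccon LE.
have cg : cont_diff 1 (grad Phi) := cont_diff_grad cPhi.
have gE tau : grad Phi (w tau) = - (K tau *m D tau).
  by rewrite /Phi -grad2_stack (sqp_newton hrun tau) opprK.
have gs0 : grad Phi ws = 0 by rewrite /Phi -grad2_stack.
pose M tau := hess Phi (w tau).
have ME tau : M tau = block_mx (hessL P (sz S tau) (slam S tau)) (G tau)^T (G tau) 0.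
  exact: (hess_stack cobj ccon LE).
(* [eps] is a relative accuracy of the quadratic model at which its remainder,
   at most [C * eps * |D|^2], stays within the margin [mu * |D|^2]. *)
pose C := 6 + (14 * (3 * Y) + 8) * (eta1 + eta2).
have C0 : 0 < C by rewrite addr_gt0// mulr_gt0 ?addr_gt0 ?mulr_gt0.
pose mu := (1 / 2 - beta) * c - (beta + delta / 2) * delta * b.
have mu0 : 0 < mu by rewrite subr_gt0.
pose eps := Num.min 1 (mu / C).
have eps0 : 0 < eps by rewrite lt_min ltr01 divr_gt0.
have eps1 : eps <= 1 by rewrite ge_min lexx.
have epsC : C * eps + (beta + delta / 2) * delta * b <= (1 / 2 - beta) * c.
  have : eps <= mu / C by rewrite ge_min lexx orbT.
  by rewrite ler_pdivlMr// /mu; lra.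
have [r1 r10 expand1] := strict_diff ws cg eps0.
have [r2 r20 expand2] := taylor2 ws cPhi eps0.
pose rr := Num.min r1 r2; have rr0 : 0 < rr by rewrite lt_min r10.
have rr2 : 0 < rr / 2 by rewrite divr_gt0.
have rr4 : 0 < rr / 4 by rewrite divr_gt0.
(* [|D|] is of the order of the gradient, which tends to 0, so eventually the
   iterate and the trial point both lie in the ball where the expansions hold. *)
pose C1 := (1 + (eta1 + eta2) * (3 * Y)) / c.
have C10 : 0 < C1 by rewrite divr_gt0// addr_gt0// mulr_gt0 ?addr_gt0 ?mulr_gt0.
have Dle tau : enorm (D tau) <= C1 * enorm (grad Phi (w tau)).
  rewrite gE enormN; apply: (newton_le heta1 heta2 c0 _ (Kle tau)) => //.
  by rewrite mulr_ge0// ltW.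
have small : 0 < rr / 4 / C1 by rewrite divr_gt0.
have [r3 r30 gsmall] := continuous_enorm ws (cont_diff_continuous cg) small.
pose r4 := Num.min (rr / 2) r3; have r40 : 0 < r4 by rewrite lt_min rr2.
have r42 : 0 < r4 / 2 by rewrite divr_gt0.
have near_z : \forall tau \near \oo, enorm (sz S tau - zs) < r4 / 2.
  exact: (hz _ (enorm_nbhs zs r42)).
have near_l : \forall tau \near \oo, enorm (slam S tau - ls) < r4 / 2.
  exact: (hl _ (enorm_nbhs ls r42)).
have near_H : \forall tau \near \oo,
    opnorm (hessL P (sz S tau) (slam S tau) - Hhat S tau) <= eps.
  move/cvgrPdist_le: hvan => /(_ eps eps0); apply: filterS => tau.
  by rewrite sub0r normrN => h; exact: le_trans (ler_norm _) h.
near=> tau.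
have wz : enorm (sz S tau - zs) < r4 / 2 by near: tau.
have wl : enorm (slam S tau - ls) < r4 / 2 by near: tau.
have wH : opnorm (hessL P (sz S tau) (slam S tau) - Hhat S tau) <= eps by near: tau.
have ww : enorm (w tau - ws) < r4.
  rewrite /w /ws opp_col_mx add_col_mx; apply: le_lt_trans (enorm_col_le _ _) _.
  by lra.
have [wr wg] : enorm (w tau - ws) < rr / 2 /\ enorm (w tau - ws) < r3.
  by move: ww; rewrite lt_min => /andP.
have dD : enorm (d tau - D tau) <= delta * enorm (D tau).
  by have := hdir tau; rewrite /d /D opp_col_mx add_col_mx.
have dsmall : enorm (d tau) < rr / 2.
  have a : enorm (d tau) <= 2 * enorm (D tau).
    rewrite -(subrK (D tau) (d tau)); apply: le_trans (enormD _ _) _.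
    have : delta * enorm (D tau) <= 1 * enorm (D tau).
      by rewrite ler_wpM2r ?enorm_ge0// ltW.
    by move: dD; lra.
  have e : enorm (D tau) < rr / 4.
    apply: le_lt_trans (Dle tau) _; rewrite mulrC -ltr_pdivlMr//.
    by have := gsmall _ wg; rewrite gs0 subr0.
  by lra.
have wd : enorm (w tau + d tau - ws) < rr.
  by rewrite addrAC; apply: le_lt_trans (enormD _ _) _; lra.
have w1 : enorm (w tau - ws) < rr by lra.
have [wd1 wd2] : enorm (w tau + d tau - ws) < r1 /\ enorm (w tau + d tau - ws) < r2.
  by move: wd; rewrite lt_min => /andP.
have [w11 w12] : enorm (w tau - ws) < r1 /\ enorm (w tau - ws) < r2.
  by move: w1; rewrite lt_min => /andP.
have MK v : enorm ((M tau - K tau) *m v) <= eps * enorm v.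
  have -> : (M tau - K tau) *m v =
      col_mx ((hessL P (sz S tau) (slam S tau) - Hhat S tau) *m usubmx v) 0.
    rewrite ME /K /KKTmx opp_block_mx add_block_mx !subrr -{1}[v]vsubmxK.
    by rewrite mul_block_col !mul0mx !addr0.
  apply: le_trans (enorm_col_le _ _) _; rewrite enorm0 addr0.
  apply: le_trans (opnorm_leP _ wH) _.
  by rewrite ler_pM2l// enorm_usub.
have step := unit_step_decrease heta1 heta2 (Ksym tau) _ (Kle tau) _ MK _ hbeta
  (gE tau) dD (expand1 _ _ w11 wd1) (expand2 _ _ w12 wd2) (bil_ge tau) b0
  (bil_le tau) epsC.
have accept : armijo P S eta1 eta2 beta tau 1.
  rewrite /armijo !scale1r mulr1 !meritE -add_col_mx -/(w tau) -/(d tau).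
  rewrite grad2_stack stack_merit_eq -/(w tau).
  rewrite -derive_dot_grad; last exact: (differentiable_stack_merit cobj ccon LE).
  rewrite (derive_stack_merit cobj ccon LE).
  apply: step; rewrite ?(ltW eps0)// ?(ltW d0) ?(ltW d1)//.
  by rewrite mulr_ge0// ltW.
have [j [aj _ hj]] := sqp_linesearch hrun tau.
rewrite aj; case: j hj {aj} => [|j] hj; first by rewrite expr0.
by case: (hj 0%N (ltn0Sn j)); rewrite expr0.
Unshelve. all: by end_near.
Qed.
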